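(* Consider Problem VaR: $\max_{X_T\in\mathcal X}\mathbb E[U((X_T-D_T)^+)]$ subject to $\mathbb P(X_T\ge L)\ge1-\alpha$ and $\mathbb E[\xi X_T]\le x_0$. Its optimal terminal wealth is as follows. (i) If $L\le D_T$: $$X_T^{VaR}=\left((U')^{-1}(\lambda_1\xi)+D_T\right)\mathbf 1_{\xi<\xi_2}\quad\text{if }\xi_2\le\xi_1,$$ $$X_T^{VaR}=\left((U')^{-1}(\lambda_1\xi)+D_T\right)\mathbf 1_{\xi<\xi_1}+L\,\mathbf 1_{\xi_1\le\xi<\xi_2}\quad\text{if }\xi_1<\xi_2,$$ where $\xi_1=U'(\widetilde L-(D_T-L))/\lambda_1$, $\widetilde L$ is the tangent point of $U((X_T-D_T+L)^+)$, $\xi_2$ is defined through $\mathbb P(\xi>\xi_2)=\alpha$, and $\lambda_1$ is obtained by solving $\mathbb E[\xi X_T^{VaR}]=x_0$. (ii) If $D_T<L\le\widehat D_T$: $$X_T^{VaR}=\left((U')^{-1}(\lambda_1\xi)+D_T\right)\mathbf 1_{\xi<\xi_2}\quad\text{if }\xi_2<\xi_1,$$ $$X_T^{VaR}=\left((U')^{-1}(\lambda_1\xi)+D_T\right)\mathbf 1_{\xi<\xi_1}+L\,\mathbf 1_{\xi_1\le\xi<\xi_2}\quad\text{if }\xi_1\le\xi_2,$$ where $\xi_1=U'(L-D_T)/\lambda_1$, $\xi_2$ is defined through $\mathbb P(\xi>\xi_2)=\alpha$, and $\lambda_1$ is obtained by solving $\mathbb E[\xi X_T^{VaR}]=x_0$.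 (iii) If $L>\widehat D_T$: $$X_T^{VaR}=\left((U')^{-1}(\lambda_1\xi)+D_T\right)\mathbf 1_{\xi<\xi_1}+L\,\mathbf 1_{\xi_1\le\xi<\xi_2}+\left((U')^{-1}(\lambda_1\xi)+D_T\right)\mathbf 1_{\xi_2<\xi<\xi_3}\quad\text{if }\xi_2<\xi_3,$$ $$X_T^{VaR}=\left((U')^{-1}(\lambda_1\xi)+D_T\right)\mathbf 1_{\xi<\xi_1}+L\,\mathbf 1_{\xi_1\le\xi<\xi_2}\quad\text{if }\xi_3\le\xi_2,$$ where $\xi_1=\frac{U'(L-D_T)}{\lambda_1}$, $\xi_2$ is defined through $\mathbb P(\xi>\xi_2)=\alpha$, $\xi_3=\frac{U'(\widehat D_T-D_T)}{\lambda_1}$, and $\lambda_1$ is obtained by solving $\mathbb E[\xi X_T^{VaR}]=x_0$.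
   Context: Market. Fix $T<\infty$ and a complete, frictionless continuous-time financial market with one risk-free asset $S_0$ and $m$ risky assets on a filtered probability space with physical measure $\mathbb P$ and unique local martingale measure $\mathbb Q$. $\mathbb E$ denotes expectation under $\mathbb P$. The state price density at time $T$ is $\xi=\frac{S_0(0)}{S_0(T)}\frac{d\mathbb Q}{d\mathbb P}$, assumed to be atomless. The initial capital is $x_0>0$, and $\mathcal X$ is the set of all $\mathcal F_T$-measurable, replicable, non-negative terminal wealths $X_T$ with $\mathbb E[\xi X_T]=x_0$. Utility and debt. $D_T>0$ is a constant (terminal debt level); $L>0$ and $\alpha\in(0,1)$ are given constants. $U:[0,\infty)\to\mathbb R$ is strictly increasing, strictly concave, continuously differentiable on $(0,\infty)$, bounded from below with $U(0)=0$, and satisfies $\lim_{x\to0}U'(x)=\infty$, $\lim_{x\to\infty}U'(x)=0$, $\limsup_{x\to\infty}xU'(x)/U(x)<1$. $(U')^{-1}$ is the inverse function of $U'$. For $d>0$ the tangent point of $U((x-d)^+)$ is the unique $\hat d>d$ with $U(\hat d-d)/\hat d=U'(\hat d-d)$; $\widehat D_T$ is the tangent point for $d=D_T$, and for $L<D_T$, $\widetilde L$ is the tangent point for $d=D_T-L$. For $L=D_T$ one reads $\xi_1=+\infty$. Standing assumptions: an optimal solution of the problem exists, and the risk constraint is non-redundant, i.e. the optimal solution $X_T^B=[(U')^{-1}(\lambda_B\xi)+D_T]\mathbf 1_{\xi<\xi_B}$ of the problem without risk constraint (with $\xi_B=U'(\widehat D_T-D_T)/\lambda_B$ and $\lambda_B$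 solving $\mathbb E[\xi X_T^B]=x_0$) violates the risk constraint. $\lambda_1$ is the Lagrangian multiplier of the budget constraint.
   Formalization: Existence of λ1 is claimed only if E[ξ L 1_{ξ<ξ2}] < x0: at equality (e.g. lognormal ξ) L 1_{ξ<ξ2} is optimal but no λ1 solves the budget equation. The assumed optimal solution is taken to have finite expected utility, since otherwise the optimum is not unique. *)

(* Defs.v *)
From HB Require Import structures.
From mathcomp Require Import all_boot all_order all_algebra.
From mathcomp Require Import all_classical all_reals all_analysis.

Set Implicit Arguments.
Unset Strict Implicit.
Unset Printing Implicit Defensive.
Import Order.TTheory GRing.Theory Num.Theory.
Import numFieldNormedType.Exports.

Local Open Scope classical_set_scope.
Local Open Scope ring_scope.

Section Market.
Context {R : realType} {d : measure_display} {Omega : measurableType d}.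

Definition process := R -> Omega -> R.

(* [price ord0] is the risk-free asset.  A strategy gives the number of units
   held of each of the m + 1 assets.  No stochastic integral is available: the
   set [integrand] of integrable predictable strategies and the operator [gains],
   gains phi t = \sum_i \int_0^t phi_i dS_i, are parameters of the market. *)
Record market (m : nat) := Market {
  horizon : R ;
  filt : R -> set (set Omega) ;
  price : 'I_m.+1 -> process ;
  integrand : set ('I_m.+1 -> process) ;
  gains : ('I_m.+1 -> process) -> process }.

Section Martingale.
Variables (T : R) (F : R -> set (set Omega)).

(* The ambient sigma-algebra of Omega is F_T. *)
Definition is_filtration : Prop :=
  [/\ forall t, 0 <= t <= T -> sigma_algebra setT (F t),
      forall s t, 0 <= s -> s <= t -> t <= T -> F s `<=` F t &
      F T = measurable].

Definition adapted (M : process) : Prop :=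
  forall t, 0 <= t <= T ->
  forall B : set R, measurable B -> F t (M t @^-1` B).

(* The last clause is E[M_t | F_s] = M_s. *)
Definition martingale (Q : probability Omega R) (M : process) : Prop :=
  [/\ adapted M,
      forall t, 0 <= t <= T -> Q.-integrable setT (EFin \o M t) &
      forall s t, 0 <= s -> s <= t -> t <= T -> forall A, F s A ->
        (\int[Q]_(w in A) (M t w)%:E = \int[Q]_(w in A) (M s w)%:E)%E].

Definition stopping_time (tau : Omega -> R) : Prop :=
  (forall w, 0 <= tau w <= T) /\
  forall t, 0 <= t <= T -> F t [set w | tau w <= t].

Definition local_martingale (Q : probability Omega R) (M : process) : Prop :=
  adapted M /\
  exists tau : nat -> Omega -> R,
  [/\ forall n, stopping_time (tau n),
      forall n w, tau n w <= tau n.+1 w,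
      {ae Q, forall w, exists n, tau n w = T} &
      forall n, martingale Q
        (fun t w => M (Num.min (tau n w) t) w - M 0 w)].

End Martingale.

Definition local_martingale_measure m (P : probability Omega R)
    (M : market m) (Q : probability Omega R) : Prop :=
  [/\ Q `<< P, P `<< Q &
      forall i, local_martingale (horizon M) (filt M) Q
        (fun t w => price M i t w / price M ord0 t w)].

(* xi = S_0(0) / S_0(T) * dQ/dP *)
Definition state_price_density m (P Q : probability Omega R)
    (M : market m) (w : Omega) : R :=
  price M ord0 0 w / price M ord0 (horizon M) w *
  fine (Radon_Nikodym (charge_of_finite_measure Q) P w).

Definition portfolio_value m (M : market m) (phi : 'I_m.+1 -> process) :
    process :=
  fun t w => \sum_i phi i t w * price M i t w.

Definition self_financing m (P : probability Omega R) (M : market m) (x : R)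
    (phi : 'I_m.+1 -> process) : Prop :=
  integrand M phi /\
  forall t, 0 <= t <= horizon M ->
    {ae P, forall w, portfolio_value M phi t w = x + gains M phi t w}.

Definition admissible m (P : probability Omega R) (M : market m)
    (phi : 'I_m.+1 -> process) : Prop :=
  forall t, 0 <= t <= horizon M ->
    {ae P, forall w, 0 <= portfolio_value M phi t w}.

Definition replicable m (P : probability Omega R) (M : market m)
    (X : Omega -> R) : Prop :=
  exists (x : R) (phi : 'I_m.+1 -> process),
  [/\ self_financing P M x phi, admissible P M phi &
      {ae P, forall w, portfolio_value M phi (horizon M) w = X w}].

Record complete_market m (P Q : probability Omega R) (M : market m) : Prop := {
  horizon_gt0 : 0 < horizon M ;
  filt_filtration : is_filtration (horizon M) (filt M) ;
  price_adapted : forall i, adapted (horizon M) (filt M) (price M i) ;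
  price0_gt0 : forall (t : R) w, 0 <= t <= horizon M -> 0 < price M ord0 t w ;
  lmm : local_martingale_measure P M Q ;
  lmm_unique : forall Q' : probability Omega R,
    local_martingale_measure P M Q' ->
    forall A, measurable A -> Q' A = Q A ;
  completeness : forall X : Omega -> R, measurable_fun setT X ->
    {ae P, forall w, 0 <= X w} ->
    ('E_P[fun w => (state_price_density P Q M w * X w)%R] < +oo)%E ->
    replicable P M X }.

End Market.

Section Utility.
Context {R : realType}.
Implicit Types (U : R -> R) (D L lam s : R).

(* Only the values of U on [0, +oo[ matter. *)
Record utility U : Prop := {
  utility_incr : forall x y : R, 0 <= x -> x < y -> U x < U y ;
  utility_concave : forall x y t : R, 0 <= x -> 0 <= y -> x != y -> 0 < t < 1 ->
    t * U x + (1 - t) * U y < U (t * x + (1 - t) * y) ;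
  utility_derivable : forall x : R, 0 < x -> derivable U x 1 ;
  utility_C1 : forall x : R, 0 < x -> {for x, continuous (derive1 U)} ;
  utility_bounded_below : exists c, forall x : R, 0 <= x -> c <= U x ;
  utility0 : U 0 = 0 ;
  utility_inada0 : derive1 U x @[x --> 0^'+] --> +oo ;
  utility_inadaoo : derive1 U x @[x --> +oo] --> (0 : R) ;
  utility_elasticity :
    (limf_esup (fun x : R => (x * derive1 U x / U x)%:E) +oo%R < 1)%E }.

Definition inv_marginal U (y : R) : R :=
  xget 0 [set x | 0 < x /\ derive1 U x = y].

(* h is the abscissa at which the line through the origin is tangent to
   x |-> U (x - c)^+. *)
Definition tangent_point U (c h : R) : Prop :=
  c < h /\ U (h - c) / h = derive1 U (h - c).

(* Terminal wealths as functions of the state price density s. *)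

Definition wealth_free U D lam s : R := inv_marginal U (lam * s) + D.

Definition wealth_B U D hatD lam s : R :=
  let xiB := derive1 U (hatD - D) / lam in
  wealth_free U D lam s * (s < xiB)%R%:R.

Definition wealth_VaR_i U D L Ltilde xi2 lam s : R :=
  let xi1 : \bar R :=
    if L == D then +oo%E else (derive1 U (Ltilde - (D - L)) / lam)%:E in
  if (xi2%:E <= xi1)%E then wealth_free U D lam s * (s < xi2)%R%:R
  else wealth_free U D lam s * (s%:E < xi1)%E%:R
       + L * ((xi1 <= s%:E)%E && (s < xi2)%R)%:R.

Definition wealth_VaR_ii U D L xi2 lam s : R :=
  let xi1 := derive1 U (L - D) / lam in
  if xi2 < xi1 then wealth_free U D lam s * (s < xi2)%R%:R
  else wealth_free U D lam s * (s < xi1)%R%:R + L * (xi1 <= s < xi2)%R%:R.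

Definition wealth_VaR_iii U D L hatD xi2 lam s : R :=
  let xi1 := derive1 U (L - D) / lam in
  let xi3 := derive1 U (hatD - D) / lam in
  if xi2 < xi3 then
    wealth_free U D lam s * (s < xi1)%R%:R + L * (xi1 <= s < xi2)%R%:R
    + wealth_free U D lam s * (xi2 < s < xi3)%R%:R
  else wealth_free U D lam s * (s < xi1)%R%:R + L * (xi1 <= s < xi2)%R%:R.

End Utility.

Section Problem.
Context {R : realType} {d : measure_display} {Omega : measurableType d}.
Variables (m : nat) (P Q : probability Omega R) (M : @market R d Omega m).
Variables (U : R -> R) (x0 D L alpha : R).

Let xi := state_price_density P Q M.

Definition terminal_wealth (X : Omega -> R) : Prop :=
  [/\ measurable_fun setT X, replicable P M X, {ae P, forall w, 0 <= X w} &
      ('E_P[fun w => (xi w * X w)%R] = x0%:E)%E].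

Definition VaR_feasible (X : Omega -> R) : Prop :=
  [/\ terminal_wealth X,
      ((1 - alpha)%:E <= P [set w | (L <= X w)%R])%E &
      ('E_P[fun w => (xi w * X w)%R] <= x0%:E)%E].

Definition objective (X : Omega -> R) : \bar R :=
  'E_P[fun w => U (Num.max (X w - D) 0)].

(* The maximum is understood to be finite. *)
Definition VaR_solution (X : Omega -> R) : Prop :=
  [/\ VaR_feasible X, (objective X < +oo)%E &
      forall Y, VaR_feasible Y -> (objective Y <= objective X)%E].

Definition budget (W : R -> R -> R) (lam : R) : Prop :=
  0 < lam /\ ('E_P[fun w => (xi w * W lam (xi w))%R] = x0%:E)%E.

(* [W lam] is the candidate wealth, as a function of xi, for the multiplier
   lam.  E[xi L 1_{xi < xi2}] is the least cost of a wealth meeting the risk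
   constraint, and the limit of the cost of [W lam] as lam -> +oo; if it equals
   x0, the budget equation may have no solution although an optimal wealth,
   L 1_{xi < xi2}, exists. *)
Definition solved_by (xi2 : R) (W : R -> R -> R) : Prop :=
  (('E_P[fun w => (xi w * (L * (xi w < xi2)%R%:R))%R] < x0%:E)%E ->
     exists lam1, budget W lam1) /\
  forall lam1, budget W lam1 ->
    VaR_solution (W lam1 \o xi) /\
    forall X, VaR_solution X -> {ae P, forall w, X w = W lam1 (xi w)}.

End Problem.

(* Main.v *)
Require Import Defs.
From mathcomp Require Import all_boot all_order all_algebra.
From mathcomp Require Import all_classical all_reals all_analysis.
From mathcomp Require Import measurable_realfun ring lra.

(** The proof is a Lagrangian argument carried out state by state. Write
    u x = U (max (x - D) 0) for the utility of terminal wealth. At a price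
    y = lam * s of one unit of wealth, let v y maximise u x - y * x over x >= 0
    and w y maximise it over x >= L. Although u is not concave, both problems
    are explicit: the marginal condition gives inv_marginal U y + D as the only
    candidate above the debt, and it has to be compared with the corner (0 or
    L). Tangency is exactly the indifference between the two, so each maximiser
    jumps, or bends, at one critical price at most ([demand_below_debt],
    [demand_at_debt], [demand_above_debt]). The record [demand] collects
    what the rest of the argument uses of v and w (maximality, almost everywhere
    uniqueness and continuity, the limit at infinity), so that the three regimes
    of L are treated together.

    Given lam, the candidate is w (lam * xi) where xi < xi2 and v (lam * xi)
    where xi > xi2: the constraint is met in the cheapest states. Its
    multiplier mu is the loss of value caused by the constraint at the boundary
    price lam * xi2. Since the loss grows with the price as long as v is below
    L, the candidate maximises u x - lam * xi * x + mu * (x >= L) at every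
    state, and strictly so outside a null set ([switch_lagrangian]). Integrating
    this inequality gives optimality and almost sure uniqueness
    ([switch_optimal]).

    This needs v (lam * xi2) < L. Non-redundancy says that it holds at the
    multiplier lamB of the unconstrained problem ([unconstrained_violates]), and
    it persists for larger multipliers. A smaller multiplier would give a
    wealth that meets the risk constraint, dominates the unconstrained optimum
    and costs the same, hence equals it, against non-redundancy
    ([budget_multiplier_ge]); this also rules out the multipliers for which the
    formulas of the statement differ from the candidate above.

    Finally, on [lamB, +oo[ the cost of the candidate is finite, continuous by
    dominated convergence because xi has no atoms, at least x0 at lamB, and
    tends to the least cost of meeting the constraint at infinity, so the
    intermediate value theorem yields the multiplier ([budget_multiplier_ex]).
    Starting at lamB is what makes the cost finite: everything is dominated by
    the cost at lamB, which exceeds that of the unconstrained optimum by a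
    bounded amount. *)

Import Order.TTheory GRing.Theory Num.Theory.
Import numFieldNormedType.Exports.

Local Open Scope classical_set_scope.
Local Open Scope ring_scope.

(** * Marginal utility and its inverse *)

Section Marginal.
Context {R : realType} (U : R -> R) (hU : utility U).

Let derive1_cvg (z : R) : 0 < z ->
  (fun h => h^-1 *: (U (h + z) - U z)) @ 0^' --> derive1 U z.
Proof.
move=> z0; have := utility_derivable hU z0.
rewrite /derivable /derive1 => /cvg_ex[l hl].
have hl' : (fun h => h^-1 *: (U (h + z) - U z)) @ 0^' --> l.
  apply: cvg_trans hl; apply: near_eq_cvg; near=> h => /=.
  by rewrite /GRing.scale /= mulr1.
by apply: cvgP hl'.
Unshelve. all: by end_near.
Qed.

Lemma concave_slope (x z t : R) : 0 <= x -> 0 <= z -> x != z -> 0 < t < 1 ->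
  t * (U x - U z) < U (t * (x - z) + z) - U z.
Proof.
move=> x0 z0 xz t01; have := utility_concave hU x0 z0 xz t01.
have -> : t * (x - z) + z = t * x + (1 - t) * z by ring.
lra.
Qed.

(** Concavity puts the slope of every chord from z towards x beyond
    U x - U z; the derivative at z is the limit of these slopes, taken from the
    side of z on which x lies. *)
Let tangent_line_ge (x z : R) : 0 <= x -> 0 < z ->
  U x <= U z + derive1 U z * (x - z).
Proof.
move=> x0 z0; have [->|xz] := eqVneq x z; first lra.
have dU := derive1_cvg z z0.
have slope (h : R) : 0 < h / (x - z) < 1 -> h / (x - z) * (U x - U z) <= U (h + z) - U z.
  move=> t01; have := concave_slope x z _ x0 (ltW z0) xz t01.
  by rewrite divfK ?subr_eq0// => /ltW.
have [xltz|zltx] := ltP x z.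
- have {}dU := cvg_dnbhs_at_left dU.
  suff : derive1 U z <= (U x - U z) / (x - z).
    by rewrite ler_ndivlMr ?subr_lt0//; lra.
  apply: (@cvgr_to_le _ _ _ _ _ _ _ dU).
  near=> h; rewrite /GRing.scale /=.
  have h0 : h < 0 by near: h; exact: nbhs_left_lt.
  have hx : x - z < h by near: h; apply: nbhs_left_gt; rewrite subr_lt0.
  have : 0 < h / (x - z) < 1.
    by rewrite ltr_ndivrMr ?subr_lt0// mul1r hx andbT nmulr_rgt0// invr_lt0 subr_lt0.
  move=> /slope sl; rewrite ler_ndivrMl//; apply: le_trans sl.
  by rewrite mulrCA mulrC.
- have {}zltx : z < x by rewrite lt_neqAle eq_sym xz.
  have {}dU := cvg_dnbhs_at_right dU.
  suff : (U x - U z) / (x - z) <= derive1 U z.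
    by rewrite ler_pdivrMr ?subr_gt0//; lra.
  apply: (@cvgr_to_ge _ _ _ _ _ _ _ dU).
  near=> h; rewrite /GRing.scale /=.
  have h0 : 0 < h by near: h; exact: nbhs_right_gt.
  have hx : h < x - z by near: h; apply: nbhs_right_lt; rewrite subr_gt0.
  have : 0 < h / (x - z) < 1.
    by rewrite ltr_pdivrMr ?subr_gt0// mul1r hx andbT divr_gt0// subr_gt0.
  move=> /slope sl; rewrite ler_pdivlMl//; apply: le_trans sl.
  by rewrite mulrCA mulrC.
Unshelve. all: by end_near.
Qed.

(** Strictness comes for free from the weak inequality at the midpoint of
    x and z, where U lies strictly above the chord. *)
Lemma tangent_line_above (x z : R) : 0 <= x -> 0 < z -> x != z ->
  U x < U z + derive1 U z * (x - z).
Proof.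
move=> x0 z0 xz.
have half01 : 0 < (2^-1 : R) < 1 by lra.
have := concave_slope x z 2^-1 x0 (ltW z0) xz half01.
have m0 : 0 <= 2^-1 * (x - z) + z by lra.
have := tangent_line_ge _ _ m0 z0.
rewrite addrK mulrCA; lra.
Qed.

Lemma marginal_gt0 (z : R) : 0 < z -> 0 < derive1 U z.
Proof.
move=> z0; have zz1 : z < z + 1 by rewrite ltrDl.
have := utility_incr hU (ltW z0) zz1.
have := tangent_line_above (z + 1) z (ltW (lt_trans z0 zz1)) z0 (negbT (gt_eqF zz1)).
by rewrite (addrC z) addrK mulr1; lra.
Qed.

Lemma marginal_decr (x z : R) : 0 < x -> x < z -> derive1 U z < derive1 U x.
Proof.
move=> x0 xz; have z0 := lt_trans x0 xz.
have h1 := tangent_line_above x z (ltW x0) z0 (negbT (lt_eqF xz)).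
have h2 := tangent_line_above z x (ltW z0) x0 (negbT (gt_eqF xz)).
have : (derive1 U z - derive1 U x) * (z - x) < 0 by lra.
by rewrite pmulr_llt0 ?subr_gt0// subr_lt0.
Qed.

(** The two Inada limits and the continuity of the marginal utility make it
    onto ]0, +oo[ by the intermediate value theorem, so that the chosen inverse
    is a genuine one at every positive price. *)
Lemma inv_marginalP (y : R) : 0 < y ->
  0 < inv_marginal U y /\ derive1 U (inv_marginal U y) = y.
Proof.
move=> y0; rewrite /inv_marginal.
suff ex : exists x, 0 < x /\ derive1 U x = y.
  exact: (@xgetPex _ 0 [set x | 0 < x /\ derive1 U x = y]).
have [a a0 ya] : exists2 a, 0 < a & y < derive1 U a.
  have : \forall x \near 0^'+, y < derive1 U x /\ 0 < x.
    near=> x; split; near: x; last exact: nbhs_right_gt.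
    by have /cvgryPgt := utility_inada0 hU; apply.
  by move=> /filter_ex[x [? ?]]; exists x.
have [b ab yb] : exists2 b, a < b & derive1 U b < y.
  have : \forall x \near +oo, derive1 U x < y /\ a < x.
    near=> x; split; near: x; last by apply: nbhs_pinfty_gt; exact: num_real.
    by have /cvgr_lt := utility_inadaoo hU; apply.
  by move=> /filter_ex[x [? ?]]; exists x.
have [c cab <-] : exists2 c, c \in `[a, b] & derive1 U c = y.
  apply: IVT; first exact: ltW.
    apply: continuous_in_subspaceT => x; rewrite inE/= in_itv/= => /andP[ax _].
    exact/(utility_C1 hU)/(lt_le_trans a0).
  by rewrite minEle maxEle (leNgt _ (derive1 U b)) (lt_trans yb ya)/= (ltW yb) (ltW ya).
exists c; split=> //; move: cab; rewrite in_itv/= => /andP[ac _].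
exact: lt_le_trans ac.
Unshelve. all: by end_near.
Qed.

Lemma inv_marginal_gt0 (y : R) : 0 < y -> 0 < inv_marginal U y.
Proof. by move=> /inv_marginalP[]. Qed.

Lemma inv_marginalK (y : R) : 0 < y -> derive1 U (inv_marginal U y) = y.
Proof. by move=> /inv_marginalP[]. Qed.

Lemma inv_marginal_le0 (y : R) : y <= 0 -> inv_marginal U y = 0.
Proof.
move=> y0; rewrite /inv_marginal; case: xgetP => // x _ [x0 xy].
by have := marginal_gt0 x x0; rewrite xy ltNge y0.
Qed.

Lemma lt_inv_marginal (x y : R) : 0 < x -> 0 < y ->
  (x < inv_marginal U y) = (y < derive1 U x).
Proof.
move=> x0 y0; have [I0 IK] := inv_marginalP y y0.
apply/idP/idP => [/(marginal_decr _ _ x0)|]; first by rewrite IK.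
rewrite -{1}IK => yx; case: (ltgtP x (inv_marginal U y)) => //.
- by move=> /(marginal_decr _ _ I0)/lt_trans/(_ yx); rewrite ltxx.
- by move=> xI; move: yx; rewrite xI ltxx.
Qed.

Lemma inv_marginal_lt (x y : R) : 0 < x -> 0 < y ->
  (inv_marginal U y < x) = (derive1 U x < y).
Proof.
move=> x0 y0; have [I0 IK] := inv_marginalP y y0.
apply/idP/idP => [/(marginal_decr _ _ I0)|]; first by rewrite IK.
rewrite -{1}IK => yx; case: (ltgtP x (inv_marginal U y)) => //.
- by move=> /(marginal_decr _ _ x0)/lt_trans/(_ yx); rewrite ltxx.
- by move=> xI; move: yx; rewrite xI ltxx.
Qed.

Lemma inv_marginal_nincr (y z : R) : 0 < y -> y <= z ->
  inv_marginal U z <= inv_marginal U y.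
Proof.
move=> y0 yz; have z0 := lt_le_trans y0 yz; rewrite leNgt.
by rewrite lt_inv_marginal ?inv_marginal_gt0// inv_marginalK// -leNgt.
Qed.

Lemma inv_marginal_cvg0 : inv_marginal U y @[y --> +oo] --> (0 : R).
Proof.
apply/cvgrPdist_lt => e e0; near=> y.
have y0 : 0 < y by near: y; apply: nbhs_pinfty_gt; exact: num_real.
rewrite sub0r normrN gtr0_norm ?inv_marginal_gt0// inv_marginal_lt//.
by near: y; apply: nbhs_pinfty_gt; exact: num_real.
Unshelve. all: by end_near.
Qed.

Lemma inv_marginal_continuous (y : R) : 0 < y ->
  {for y, continuous (inv_marginal U)}.
Proof.
move=> y0; have I0 := inv_marginal_gt0 y y0; apply/cvgrPdist_lt => e e0.
have lo (x : R) : x < inv_marginal U y -> \forall z \near y, x < inv_marginal U z.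
  move=> xI; have [x0|x0] := leP x 0.
    near=> z; apply: (le_lt_trans x0); apply: inv_marginal_gt0.
    by near: z; exact: lt_nbhsr.
  near=> z; rewrite lt_inv_marginal//.
    by near: z; apply: lt_nbhsl; rewrite -lt_inv_marginal.
  by near: z; exact: lt_nbhsr.
have hi : \forall z \near y, inv_marginal U z < inv_marginal U y + e.
  near=> z; rewrite inv_marginal_lt ?addr_gt0//; last first.
    by near: z; exact: lt_nbhsr.
  by near: z; apply: lt_nbhsr; rewrite -inv_marginal_lt ?addr_gt0// ltrDl.
near=> z; rewrite distrC ltr_distl; apply/andP; split; near: z => //.
by apply: lo; rewrite ltrBlDr ltrDl.
Unshelve. all: by end_near.
Qed.

(** The inverse is monotone on positive prices only, so it is read as a
    monotone function of the logarithm of the price. *)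
Lemma measurable_inv_marginal : measurable_fun setT (inv_marginal U).
Proof.
have meas_neg : measurable_fun setT (fun y : R => inv_marginal U (expR y)).
  apply: nonincreasing_measurable => // y z yz.
  by apply: inv_marginal_nincr; rewrite ?expR_gt0// ler_expR.
rewrite (_ : inv_marginal U = fun y =>
  if 0 < y then inv_marginal U (expR (ln y)) else 0); last first.
  apply/funext => y; case: ltP => [y0|/inv_marginal_le0//].
  by rewrite lnK.
apply: measurable_fun_ifT => //; first exact: measurable_fun_ltr.
exact: (measurableT_comp meas_neg (@measurable_ln R)).
Qed.

End Marginal.

(** * Demand at a given price *)

(** Optimal wealth above the floor l, as a function of its unit price. The
    price k is the one at which the maximiser may fail to be unique; since the
    density has no atoms, a single exceptional price is harmless, for uniqueness
    as for continuity. *)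
Record demand {R : realType} (u : R -> R) (l k : R) (f : R -> R) : Prop := {
  demand_ge : forall y, 0 < y -> l <= f y ;
  demand_max : forall y x, 0 < y -> l <= x ->
    u x - y * x <= u (f y) - y * f y ;
  demand_uniq : forall y x, 0 < y -> y != k -> l <= x -> x != f y ->
    u x - y * x < u (f y) - y * f y ;
  demand_continuous : forall y, 0 < y -> y != k -> {for y, continuous f} ;
  demand_cvg : f y @[y --> +oo] --> l ;
  demand_measurable : measurable_fun setT f }.

Arguments demand_ge {R u l k f} _ {y}.
Arguments demand_max {R u l k f} _ {y x}.
Arguments demand_uniq {R u l k f} _ {y x}.
Arguments demand_continuous {R u l k f} _ {y}.
Arguments demand_cvg {R u l k f} _.
Arguments demand_measurable {R u l k f} _.

(** Revealed preference: adding the two optimality inequalities, the utility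
    terms cancel. *)
Lemma demand_nincr {R : realType} {u : R -> R} {l k : R} {f : R -> R} :
  demand u l k f -> forall y z, 0 < y -> y <= z -> f z <= f y.
Proof.
move=> df y z y0; rewrite le_eqVlt => /predU1P[->//|yz].
have z0 := lt_trans y0 yz.
have h1 := demand_max df y0 (demand_ge df z0).
have h2 := demand_max df z0 (demand_ge df y0).
have : (z - y) * (f z - f y) <= 0 by lra.
by rewrite pmulr_rle0 ?subr_gt0// subr_le0.
Qed.

(** An optimum for the lower floor that clears the higher one is feasible for
    both, and strict uniqueness at the lower floor identifies the two. *)
Lemma demand_eq {R : realType} {u : R -> R} {l1 l2 k1 k2 : R} {f1 f2 : R -> R} :
  demand u l1 k1 f1 -> demand u l2 k2 f2 -> l1 <= l2 ->
  forall y, 0 < y -> y != k1 -> l2 <= f1 y -> f2 y = f1 y.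
Proof.
move=> df1 df2 l12 y y0 yk1 lf; apply/eqP/negPn/negP => neq.
have := demand_uniq df1 y0 yk1 (le_trans l12 (demand_ge df2 y0)) neq.
by rewrite ltNge (demand_max df2 y0 lf).
Qed.

Lemma demand_le {R : realType} {u : R -> R} {l1 l2 k1 k2 : R} {f1 f2 : R -> R} :
  demand u l1 k1 f1 -> demand u l2 k2 f2 -> l1 <= l2 ->
  forall y, 0 < y -> y != k1 -> f1 y <= f2 y.
Proof.
move=> df1 df2 l12 y y0 yk1; have [lf|fl] := leP l2 (f1 y).
  by rewrite (demand_eq df1 df2 l12 y y0 yk1 lf).
exact: le_trans (ltW fl) (demand_ge df2 y0).
Qed.

Definition debt_utility {R : realType} (U : R -> R) (D x : R) : R :=
  U (Num.max (x - D) 0).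

Definition cutoff {R : realType} (g : R -> R) (l k y : R) : R :=
  if y < k then g y else l.

Section Cutoff.
Context {R : realType} (g : R -> R) (l k : R).

Lemma cutoff_continuous (y : R) : {for y, continuous g} -> y != k ->
  {for y, continuous (cutoff g l k)}.
Proof.
move=> cg; rewrite neq_lt => /orP[yk|ky].
- rewrite /prop_for /continuous_at {2}/cutoff yk.
  apply: cvg_trans cg; apply: near_eq_cvg; near=> z.
  by rewrite /cutoff ifT//; near: z; exact: lt_nbhsl.
- rewrite /prop_for /continuous_at {2}/cutoff ltNge (ltW ky)/=.
  apply: cvg_near_cst; near=> z.
  by rewrite /cutoff ltNge ltW//; near: z; exact: lt_nbhsr.
Unshelve. all: by end_near.
Qed.

Lemma cutoff_cvg : cutoff g l k y @[y --> +oo] --> l.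
Proof.
apply: cvg_near_cst; near=> z; rewrite /cutoff ltNge ltW//.
by near: z; apply: nbhs_pinfty_gt; exact: num_real.
Unshelve. all: by end_near.
Qed.

Lemma measurable_cutoff : measurable_fun setT g ->
  measurable_fun setT (cutoff g l k).
Proof.
by move=> mg; apply: measurable_fun_ifT => //; exact: measurable_fun_ltr.
Qed.

End Cutoff.

Section DebtUtility.
Context {R : realType} (U : R -> R) (D : R) (hU : utility U).

Local Notation u := (debt_utility U D).
Local Notation free y := (inv_marginal U y + D).

Lemma debt_utility_solvent (x : R) : D <= x -> u x = U (x - D).
Proof. by move=> Dx; rewrite /debt_utility (max_idPl _) ?subr_ge0. Qed.

Lemma debt_utility_insolvent (x : R) : x <= D -> u x = 0.
Proof.
by move=> xD; rewrite /debt_utility (max_idPr _) ?subr_le0// (utility0 hU).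
Qed.

Lemma utility_ge0 (x : R) : 0 <= x -> 0 <= U x.
Proof.
rewrite le_eqVlt => /predU1P[<-|x0]; first by rewrite (utility0 hU).
by rewrite -{1}(utility0 hU) ltW// (utility_incr hU).
Qed.

Lemma debt_utility_ge0 (x : R) : 0 <= u x.
Proof. by apply: utility_ge0; rewrite le_max lexx orbT. Qed.

Lemma measurable_debt_utility : measurable_fun setT u.
Proof.
apply: nondecreasing_measurable => // x y xy; rewrite /debt_utility.
set a := Num.max (x - D) 0; set b := Num.max (y - D) 0.
have ab : a <= b.
  by rewrite /a ge_max !le_max lexx orbT andbT lerD2r xy.
have a0 : 0 <= a by rewrite le_max lexx orbT.
move: ab; rewrite le_eqVlt => /predU1P[->//|ab].
by rewrite ltW// (utility_incr hU).
Qed.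

Lemma free_uniq (y x : R) : 0 < y -> D <= x -> x != free y ->
  u x - y * x < U (inv_marginal U y) - y * free y.
Proof.
move=> y0 Dx xf; rewrite debt_utility_solvent//.
have xD : x - D != inv_marginal U y by rewrite subr_eq.
have xD0 : 0 <= x - D by rewrite subr_ge0.
have := tangent_line_above U hU _ _ xD0 (inv_marginal_gt0 U hU y y0) xD.
by rewrite inv_marginalK//; lra.
Qed.

Lemma debt_utility_free (y : R) : 0 < y -> u (free y) = U (inv_marginal U y).
Proof.
move=> y0; have I0 := inv_marginal_gt0 U hU y y0.
by rewrite debt_utility_solvent ?addrK// lerDr ltW.
Qed.

(** Above the debt the utility is concave, and the tangent line at
    inv_marginal U y has slope y. *)
Lemma free_max (y x : R) : 0 < y -> D <= x ->
  u x - y * x <= U (inv_marginal U y) - y * free y.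
Proof.
move=> y0 Dx; have [->|xf] := eqVneq x (free y).
  by rewrite debt_utility_free.
exact/ltW/free_uniq.
Qed.

Lemma free_continuous (y : R) : 0 < y -> {for y, continuous (fun y => free y)}.
Proof.
by move=> y0; apply: cvgD; [exact: inv_marginal_continuous|exact: cvg_cst].
Qed.

Lemma measurable_free : measurable_fun setT (fun y => free y).
Proof. by apply: measurable_funD => //; exact: measurable_inv_marginal. Qed.

(** Below the debt level the utility vanishes, so the only rival of the
    marginal optimum is the floor l. Tangency from the point (l, 0) means that
    at the price k the two give the same value. *)
Lemma demand_below_debt (l h : R) : l < D -> tangent_point U (D - l) h ->
  let k := derive1 U (h - (D - l)) in
  demand u l k (cutoff (fun y => free y) l k).
Proof.
move=> lD [ch]; set z := h - (D - l); move=> tg k.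
have z0 : 0 < z by rewrite subr_gt0.
have h0 : 0 < h by apply: lt_trans ch; rewrite subr_gt0.
have Uz : U z = k * (z + (D - l)).
  by rewrite /k -tg /z subrK divfK ?gt_eqF.
(* the advantage of the marginal optimum over the floor; it changes sign at k *)
pose gain y := U (inv_marginal U y) - y * free y + y * l.
have gain_gt0 y : 0 < y -> y < k -> 0 < gain y.
  move=> y0 yk.
  have DzD : D <= z + D by rewrite lerDr ltW.
  have := free_max y (z + D) y0 DzD.
  rewrite (debt_utility_solvent _ DzD) addrK Uz /gain.
  have : 0 < (k - y) * (z + (D - l)) by rewrite mulr_gt0 ?subr_gt0//; lra.
  lra.
have k0 : 0 < k by exact: marginal_gt0.
have gain_le y : 0 < y -> gain y <= (k - y) * (inv_marginal U y + (D - l)).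
  move=> y0; have I0 := inv_marginal_gt0 U hU y y0.
  have [Iz|Iz] := eqVneq (inv_marginal U y) z.
    by rewrite /gain Iz Uz; lra.
  have := tangent_line_above U hU _ _ (ltW I0) z0 Iz; rewrite -/k Uz /gain; lra.
have gain_le0 y : 0 < y -> k <= y -> gain y <= 0.
  move=> y0 ky; apply: le_trans (gain_le y y0) _; rewrite mulr_le0_ge0 ?subr_le0//.
  by rewrite addr_ge0 ?subr_ge0 ?ltW// inv_marginal_gt0.
have gain_lt0 y : 0 < y -> k < y -> gain y < 0.
  move=> y0 ky; apply: le_lt_trans (gain_le y y0) _; rewrite nmulr_rlt0 ?subr_lt0//.
  by rewrite addr_gt0 ?subr_gt0// inv_marginal_gt0.
have ul : u l = 0 by rewrite debt_utility_insolvent ?ltW.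
split.
- move=> y y0; rewrite /cutoff; case: ifPn => // _.
  by have := inv_marginal_gt0 U hU y y0; lra.
- move=> y x y0 lx.
  have yx : y * l <= y * x by rewrite ler_pM2l.
  rewrite /cutoff; case: ltP => [yk|ky].
    rewrite debt_utility_free//; have [Dx|xD] := leP D x; first exact: free_max.
    rewrite (debt_utility_insolvent _ (ltW xD)); have := gain_gt0 y y0 yk.
    by rewrite /gain; lra.
  rewrite ul; have [Dx|xD] := leP D x.
    have := gain_le0 y y0 ky; have := free_max y x y0 Dx; rewrite /gain; lra.
  by rewrite (debt_utility_insolvent _ (ltW xD)); lra.
- move=> y x y0 yk lx; rewrite /cutoff; case: ltP => [{}yk|ky] xneq.
    rewrite debt_utility_free//; have [Dx|xD] := leP D x; first exact: free_uniq.
    rewrite (debt_utility_insolvent _ (ltW xD)); have := gain_gt0 y y0 yk.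
    have yx : y * l <= y * x by rewrite ler_pM2l.
    by rewrite /gain; lra.
  have {yk}ky : k < y by rewrite lt_neqAle eq_sym yk.
  have yx : y * l < y * x by rewrite ltr_pM2l// lt_neqAle eq_sym xneq.
  rewrite ul; have [Dx|xD] := leP D x.
    have := gain_lt0 y y0 ky; have := free_max y x y0 Dx; rewrite /gain; lra.
  by rewrite (debt_utility_insolvent _ (ltW xD)); lra.
- by move=> y y0; apply: cutoff_continuous; exact: free_continuous.
- exact: cutoff_cvg.
- by apply: measurable_cutoff; exact: measurable_free.
Qed.

(** At l = D the floor is the vertex of the utility, whose infinite slope
    there makes the marginal optimum best at every price: this is the case of
    an infinite switching price, and the value 0 of k excludes no positive
    price. *)
Lemma demand_at_debt : demand u D 0 (fun y => free y).
Proof.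
split.
- by move=> y y0; rewrite lerDr ltW// inv_marginal_gt0.
- by move=> y x y0 Dx; rewrite debt_utility_free//; exact: free_max.
- by move=> y x y0 _ Dx xf; rewrite debt_utility_free//; exact: free_uniq.
- by move=> y y0 _; exact: free_continuous.
- rewrite -[X in _ --> X]add0r; apply: cvgD; last exact: cvg_cst.
  exact: inv_marginal_cvg0.
- exact: measurable_free.
Qed.

(** On [l, +oo[ the utility is concave, so the optimum is the marginal one
    truncated at l. *)
Lemma demand_above_debt (l : R) : D < l ->
  let k := derive1 U (l - D) in
  demand u l k (cutoff (fun y => free y) l k).
Proof.
move=> Dl k; have l0 : 0 < l - D by rewrite subr_gt0.
have ul : u l = U (l - D) by rewrite debt_utility_solvent ?ltW.
have uniq y x : 0 < y -> l <= x -> x != cutoff (fun y => free y) l k y ->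
    u x - y * x < u (cutoff (fun y => free y) l k y)
      - y * cutoff (fun y => free y) l k y.
  move=> y0 lx; have Dx : D <= x by exact: le_trans (ltW Dl) lx.
  rewrite /cutoff; case: ltP => [yk xf|ky xl].
    by rewrite debt_utility_free//; exact: free_uniq.
  have {}lx : l < x by rewrite lt_neqAle eq_sym xl.
  have xD0 : 0 <= x - D by rewrite subr_ge0.
  have xlD : x - D != l - D by rewrite (inj_eq (addIr _)) gt_eqF.
  have := tangent_line_above U hU _ _ xD0 l0 xlD.
  rewrite ul debt_utility_solvent// -/k.
  have : k * (x - l) <= y * (x - l) by rewrite ler_pM2r// subr_gt0.
  lra.
split.
- move=> y y0; rewrite /cutoff; case: ltP => // yk.
  by rewrite -lerBlDr ltW// lt_inv_marginal.
- move=> y x y0 lx; have [<-//|xneq] := eqVneq x (cutoff (fun y => free y) l k y).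
  exact/ltW/uniq.
- by move=> y x y0 _; exact: uniq.
- by move=> y y0; apply: cutoff_continuous; exact: free_continuous.
- exact: cutoff_cvg.
- by apply: measurable_cutoff; exact: measurable_free.
Qed.

(** For small prices the cutoff is inactive and, by the Inada condition at 0,
    demand is unbounded. *)
Lemma cutoff_free_large (l k b : R) : 0 < k ->
  exists2 y, 0 < y & b <= cutoff (fun y => free y) l k y.
Proof.
move=> k0; pose x := Num.max (b - D) (inv_marginal U k) + 1.
have Ix : inv_marginal U k < x by rewrite ltr_pwDr// le_max lexx orbT.
have bx : b - D < x by rewrite ltr_pwDr// le_max lexx.
have x0 : 0 < x := lt_trans (inv_marginal_gt0 U hU k k0) Ix.
have y0 := marginal_gt0 U hU x x0; exists (derive1 U x) => //.
rewrite /cutoff -(inv_marginal_lt U hU)// Ix -lerBlDr (le_trans (ltW bx))//.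
by rewrite leNgt inv_marginal_lt// ltxx.
Qed.

End DebtUtility.

(** * Almost everywhere comparison of integrals *)

Lemma measurable_lt {R : realType} {d : measure_display} {T : measurableType d}
    (X Y : T -> R) : measurable_fun setT X -> measurable_fun setT Y ->
  measurable [set o | X o < Y o].
Proof.
move=> mX mY; rewrite -[X in measurable X]setTI.
exact: (measurable_fun_ltr mX mY measurableT (_ : measurable [set true])).
Qed.

Lemma measurable_le {R : realType} {d : measure_display} {T : measurableType d}
    (X Y : T -> R) : measurable_fun setT X -> measurable_fun setT Y ->
  measurable [set o | X o <= Y o].
Proof.
move=> mX mY; rewrite -[X in measurable X]setTI.
exact: (measurable_fun_ler mX mY measurableT (_ : measurable [set true])).
Qed.

Lemma measurable_natmul_bool {R : realType} {d : measure_display}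
    {T : measurableType d} (b : T -> bool) : measurable_fun setT b ->
  measurable_fun setT (fun o => (b o)%:R : R).
Proof.
by move=> mb; apply: (measurableT_comp (f := fun c : bool => (c%:R : R))).
Qed.

Section AlmostEverywhere.
Context {R : realType} {d : measure_display} {T : measurableType d}.
Variable mu : {measure set T -> \bar R}.

Lemma ae_le_integrable {f g : T -> R} : measurable_fun setT f ->
  {ae mu, forall x, `|f x| <= g x} -> mu.-integrable setT (EFin \o g) ->
  mu.-integrable setT (EFin \o f).
Proof.
move=> mf fg /integrableP[mg goo]; apply/integrableP; split.
  exact/measurable_EFinP.
apply: le_lt_trans goo; apply: ae_ge0_le_integral => //.
- by apply: measurableT_comp => //; exact/measurable_EFinP.
- exact: measurableT_comp.
- apply: filterS fg => x fgx _ /=.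
  by rewrite lee_fin; exact: le_trans fgx (ler_norm _).
Qed.

Let ae_ge0_integral_abs (f : T -> R) : measurable_fun setT f ->
  {ae mu, forall x, 0 <= f x} ->
  (\int[mu]_x (f x)%:E = \int[mu]_x `|(f x)%:E|)%E.
Proof.
move=> mf f0; apply: ae_eq_integral => //.
- exact/measurable_EFinP.
- by apply: measurableT_comp => //; exact/measurable_EFinP.
- by apply: filterS f0 => x f0 _ /=; rewrite ger0_norm.
Qed.

Lemma ae_ge0_integrable {f : T -> R} : measurable_fun setT f ->
  {ae mu, forall x, 0 <= f x} -> (\int[mu]_x (f x)%:E < +oo)%E ->
  mu.-integrable setT (EFin \o f).
Proof.
move=> mf f0 foo; apply/integrableP; split; first exact/measurable_EFinP.
by rewrite -ae_ge0_integral_abs.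
Qed.

Lemma ae_ge0_Rintegral {f : T -> R} : mu.-integrable setT (EFin \o f) ->
  {ae mu, forall x, 0 <= f x} -> 0 <= \int[mu]_x f x.
Proof.
move=> /measurable_int/measurable_EFinP mf f0.
by rewrite /Rintegral ae_ge0_integral_abs// fine_ge0// integral_ge0.
Qed.

Lemma ae_ge0_Rintegral_le0 {f : T -> R} : mu.-integrable setT (EFin \o f) ->
  {ae mu, forall x, 0 <= f x} -> \int[mu]_x f x <= 0 ->
  {ae mu, forall x, f x = 0}.
Proof.
move=> intf f0 If; have /measurable_int/measurable_EFinP mf := intf.
have : (\int[mu]_x `|(EFin \o f) x| = 0)%E.
  rewrite -ae_ge0_integral_abs//; apply/eqP; rewrite eq_le.
  have If0 := ae_ge0_Rintegral intf f0; move: If If0.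
  have fin := integrable_fin_num measurableT intf.
  by rewrite /Rintegral -!lee_fin fineK// => -> ->.
move=> /ae_eq_integral_abs -/(_ measurableT) [].
  exact/measurable_EFinP.
by move=> N [mN N0 fN]; exists N; split => // x /= nf; apply: fN => /= fx; apply: nf; case: (fx I).
Qed.

Lemma ae_le_Rintegral {f g : T -> R} :
  mu.-integrable setT (EFin \o f) -> mu.-integrable setT (EFin \o g) ->
  {ae mu, forall x, f x <= g x} -> \int[mu]_x f x <= \int[mu]_x g x.
Proof.
move=> intf intg fg; rewrite -subr_ge0 -RintegralB//; apply: ae_ge0_Rintegral.
  exact: (@integrableB _ _ _ _ _ _ _ _ intg intf).
by apply: filterS fg => x; rewrite subr_ge0.
Qed.

Lemma ae_le_Rintegral_eq {f g : T -> R} :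
  mu.-integrable setT (EFin \o f) -> mu.-integrable setT (EFin \o g) ->
  {ae mu, forall x, f x <= g x} -> \int[mu]_x g x <= \int[mu]_x f x ->
  {ae mu, forall x, f x = g x}.
Proof.
move=> intf intg fg gf.
have intgf : mu.-integrable setT (EFin \o (fun x => g x - f x)).
  exact: (@integrableB _ _ _ _ _ _ _ _ intg intf).
have gf0 : {ae mu, forall x, 0 <= g x - f x}.
  by apply: filterS fg => x; rewrite subr_ge0.
have : \int[mu]_x (g x - f x) <= 0 by rewrite RintegralB// subr_le0.
move=> /(ae_ge0_Rintegral_le0 intgf gf0); apply: filterS => x /eqP.
by rewrite subr_eq0 => /eqP.
Qed.

End AlmostEverywhere.

(** * Pointwise optimality under the risk constraint *)

(** Prices below y2 are those of the states in which the constraint is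
    enforced. *)
Definition switch {R : realType} (w v : R -> R) (y2 y : R) : R :=
  if y < y2 then w y else v y.

Section Switch.
Context {R : realType} {u w v : R -> R} {L kw kv : R}.
Hypothesis L0 : 0 <= L.
Hypothesis hw : demand u L kw w.
Hypothesis hv : demand u 0 kv v.

(** The multiplier of the risk constraint: the value lost by imposing the
    floor at the boundary price y2. *)
Definition constraint_price (y2 : R) : R :=
  (u (v y2) - y2 * v y2) - (u (w y2) - y2 * w y2).

Lemma constraint_price_ge0 y2 : 0 < y2 -> 0 <= constraint_price y2.
Proof.
move=> y20; rewrite subr_ge0; apply: (demand_max hv) => //.
exact: le_trans L0 (demand_ge hw y20).
Qed.

Lemma switch_ge0 (y2 y : R) : 0 < y -> 0 <= switch w v y2 y.
Proof.
move=> y0; rewrite /switch; case: ifPn => _; last exact: (demand_ge hv).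
exact: le_trans L0 (demand_ge hw y0).
Qed.

Lemma switch_meets (y2 y : R) : 0 < y2 -> v y2 < L -> 0 < y ->
  (L <= switch w v y2 y) = (y < y2).
Proof.
move=> y20 vL y0; rewrite /switch; case: ltP => yy2.
  by rewrite (demand_ge hw).
by apply/negbTE; rewrite -ltNge (le_lt_trans (demand_nincr hv _ _ y20 yy2)).
Qed.

(** The value lost by imposing the floor grows strictly with the price, since
    its rate of change is w - v and w y2 >= L > v y2. So, at the multiplier
    fixed by the price y2, imposing the floor pays exactly below y2. The proof
    avoids the value functions: it compares with the maximisers at y2 and uses
    that y |-> u x - y * x is affine. *)
Lemma switch_lagrangian (y2 y x : R) : 0 < y2 -> v y2 < L ->
  0 < y -> y != y2 -> y != kw -> y != kv -> 0 <= x -> x != switch w v y2 y ->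
  u x - y * x + constraint_price y2 * (L <= x)%R%:R <
  u (switch w v y2 y) - y * switch w v y2 y
    + constraint_price y2 * (y < y2)%R%:R.
Proof.
move=> y20 vL y0 yy2 ykw ykv x0; rewrite /switch; case: ltP => [yy|yy] xneq.
- have [Lx|xL] := leP L x.
    by rewrite ltrD2r; exact: (demand_uniq hw).
  rewrite mulr0 mulr1 addr0 /constraint_price.
  have h1 := demand_max hv y20 x0.
  have h2 := demand_max hw y0 (demand_ge hw y20).
  have : (y2 - y) * x < (y2 - y) * w y2.
    by rewrite ltr_pM2l ?subr_gt0//; exact: lt_le_trans xL (demand_ge hw y20).
  lra.
- have {yy2}yy : y2 < y by rewrite lt_neqAle eq_sym yy2.
  have [Lx|xL] := leP L x; last first.
    by rewrite !mulr0 !addr0; exact: (demand_uniq hv).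
  rewrite mulr0 mulr1 addr0 /constraint_price.
  have h1 := demand_max hw y20 Lx.
  have h2 := demand_max hv y0 (demand_ge hv y20).
  have : (y - y2) * v y2 < (y - y2) * x.
    by rewrite ltr_pM2l ?subr_gt0//; exact: lt_le_trans vL Lx.
  lra.
Qed.

Lemma measurable_switch y2 : measurable_fun setT (switch w v y2).
Proof.
apply: measurable_fun_ifT.
- exact: measurable_fun_ltr.
- exact: demand_measurable hw.
- exact: demand_measurable hv.
Qed.

End Switch.

(** * Optimal wealth as a function of an atomless density *)

Section Density.
Context {R : realType} {d : measure_display} {Omega : measurableType d}.
Variables (P : probability Omega R) (xi : Omega -> R).
Hypothesis mxi : measurable_fun setT xi.
Hypothesis xi_gt0 : {ae P, forall o, 0 < xi o}.
Hypothesis xi_atomless : forall c : R, P [set o | xi o = c] = 0%E.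
Context {alpha xi2 : R}.
Hypothesis alpha01 : 0 < alpha < 1.
Hypothesis tail_xi2 : P [set o | xi2 < xi o] = alpha%:E.

Lemma ae_density_neq (c : R) : {ae P, forall o, xi o != c}.
Proof.
exists [set o | xi o = c]; split => //.
  have -> : [set o | xi o = c] = setT `&` (xi @^-1` [set c]).
    by apply/seteqP; split => o //= [].
  exact: mxi.
by move=> o /= /negP; rewrite negbK => /eqP.
Qed.

Lemma ae_scaled_density_neq (lam c : R) : 0 < lam ->
  {ae P, forall o, lam * xi o != c}.
Proof.
move=> lam0; apply: filterS (ae_density_neq (lam^-1 * c)) => o.
by apply: contra => /eqP <-; rewrite mulKf// gt_eqF.
Qed.

Lemma ae_probability_le (A B : set Omega) : measurable A -> measurable B ->
  {ae P, forall o, A o -> B o} -> (P A <= P B)%E.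
Proof.
move=> mA mB [N [mN N0 AB]]; apply: (@le_trans _ _ (P (B `|` N))); last first.
  by have := measureU2 P mB mN; rewrite [X in (_ <= _ + X)%E]N0 adde0.
apply: le_measure; rewrite ?inE//; first exact: measurableU.
move=> o Ao /=; have [Bo|nBo] := pselect (B o); first by left.
by right; apply: AB => /= /(_ Ao).
Qed.

Lemma probability_below_quantile :
  P [set o | xi o < xi2] = (1 - alpha)%:E.
Proof.
have mgt : measurable [set o | xi2 < xi o] by exact: measurable_lt.
rewrite EFinB -tail_xi2 -(probability_setC P mgt).
apply/eqP; rewrite eq_le; apply/andP; split.
  apply: le_measure; rewrite ?inE; [exact: measurable_lt|exact: measurableC|].
  by move=> o /= xs; apply/negP; rewrite -leNgt ltW.
apply: ae_probability_le; [exact: measurableC|exact: measurable_lt|].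
apply: filterS (ae_density_neq xi2) => o xs /negP.
by rewrite -leNgt le_eqVlt (negbTE xs).
Qed.

Lemma quantile_gt0 : 0 < xi2.
Proof.
rewrite ltNge; apply/negP => quantile_gt0.
have : (1 - alpha)%:E = 0 :> \bar R.
  rewrite -probability_below_quantile.
  have [N [mN N0 Npos]] := xi_gt0.
  apply: (subset_measure0 _ mN _ N0); first exact: measurable_lt.
  by move=> o /= xs; apply: Npos => /=; apply/negP; rewrite -leNgt (le_trans (ltW xs)).
by move=> [] /eqP; rewrite subr_eq0 => /eqP a1; move: alpha01; rewrite -a1 ltxx andbF.
Qed.

Lemma quantile_le_constraint {B : Omega -> R} {L : R} : measurable_fun setT B ->
  {ae P, forall o, xi o < xi2 -> L <= B o} ->
  ((1 - alpha)%:E <= P [set o | (L <= B o)%R])%E.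
Proof.
move=> mB LB; rewrite -probability_below_quantile.
by apply: ae_probability_le => //; [exact: measurable_lt|exact: measurable_le].
Qed.

(** A dominating wealth of the same cost is almost surely the same wealth,
    because the density is positive. *)
Lemma same_cost_feasible {B W : Omega -> R} {L : R} :
  measurable_fun setT B ->
  P.-integrable setT (EFin \o (fun o => xi o * B o)) ->
  P.-integrable setT (EFin \o (fun o => xi o * W o)) ->
  {ae P, forall o, B o <= W o} ->
  {ae P, forall o, xi o < xi2 -> L <= W o} ->
  \int[P]_o (xi o * W o) <= \int[P]_o (xi o * B o) ->
  ((1 - alpha)%:E <= P [set o | (L <= B o)%R])%E.
Proof.
move=> mB iB iW BW LW WB; apply: quantile_le_constraint => //.
have cBW : {ae P, forall o, xi o * B o <= xi o * W o}.
  by apply: filterS2 xi_gt0 BW => o xi0; rewrite ler_pM2l.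
apply: filterS3 xi_gt0 LW (ae_le_Rintegral_eq _ iB iW cBW WB) => o xi0 LWo.
by move=> /(mulfI (lt0r_neq0 xi0)) ->.
Qed.

Section Verification.
Context {u w v : R -> R} {L kw kv : R}.
Hypothesis L0 : 0 <= L.
Hypothesis hw : demand u L kw w.
Hypothesis hv : demand u 0 kv v.

(** Integrating the strict pointwise inequality of [switch_lagrangian]: the
    cost terms cancel since both wealths exhaust the budget, and the constraint
    terms have the right sign since W meets the floor with probability exactly
    1 - alpha. If the expected utilities agree, the integrated inequality is an
    equality, so the strict one can only hold on a null set. *)
Lemma switch_optimal (lam : R) (X W : Omega -> R) :
  0 < lam -> v (lam * xi2) < L ->
  (forall o, 0 < xi o -> xi o != xi2 ->
    W o = switch w v (lam * xi2) (lam * xi o)) ->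
  measurable_fun setT X -> {ae P, forall o, 0 <= X o} ->
  ((1 - alpha)%:E <= P [set o | (L <= X o)%R])%E ->
  P.-integrable setT (EFin \o (fun o => xi o * X o)) ->
  P.-integrable setT (EFin \o (fun o => xi o * W o)) ->
  \int[P]_o (xi o * X o) = \int[P]_o (xi o * W o) ->
  P.-integrable setT (EFin \o (fun o => u (X o))) ->
  P.-integrable setT (EFin \o (fun o => u (W o))) ->
  \int[P]_o u (X o) <= \int[P]_o u (W o) /\
  (\int[P]_o u (W o) <= \int[P]_o u (X o) -> {ae P, forall o, X o = W o}).
Proof.
move=> lam0 vL WE mX X0 PX iX iW XW iuX iuW.
set y2 := lam * xi2; pose mu := constraint_price y2 (u := u) (w := w) (v := v).
have y20 : 0 < y2 by rewrite mulr_gt0// quantile_gt0.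
pose a : Omega -> R := \1_[set o | xi o < xi2].
pose b : Omega -> R := \1_[set o | L <= X o].
have mA : measurable [set o | xi o < xi2] by exact: measurable_lt.
have mB : measurable [set o | L <= X o] by exact: measurable_le.
have ia : P.-integrable setT (EFin \o a) by exact: integrable_indic.
have ib : P.-integrable setT (EFin \o b) by exact: integrable_indic.
pose f o := u (X o) + lam * (xi o * W o) + mu * b o.
pose g o := u (W o) + lam * (xi o * X o) + mu * a o.
have iZ (c : R) (h : Omega -> R) : P.-integrable setT (EFin \o h) ->
    P.-integrable setT (EFin \o (fun o => c * h o)).
  by move=> ih; exact: (integrableZl measurableT c ih).
have iD (h1 h2 : Omega -> R) : P.-integrable setT (EFin \o h1) ->
    P.-integrable setT (EFin \o h2) ->
    P.-integrable setT (EFin \o (fun o => h1 o + h2 o)).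
  by move=> ih1 ih2; exact: (integrableD measurableT ih1 ih2).
have iff : P.-integrable setT (EFin \o f).
  by apply/iD; [apply/iD => //; exact: iZ|exact: iZ].
have ig : P.-integrable setT (EFin \o g).
  by apply/iD; [apply/iD => //; exact: iZ|exact: iZ].
have [aE bE] : (forall o, a o = (xi o < xi2)%R%:R) /\
    (forall o, b o = (L <= X o)%R%:R).
  by split=> o; rewrite /a /b indicE; congr (nat_of_bool _)%:R; apply/idP/idP; rewrite inE.
have strict : {ae P, forall o, f o <= g o /\ (X o != W o -> f o < g o)}.
  apply: filterS3 xi_gt0 (filterI X0 (ae_density_neq xi2))
    (filterI (ae_scaled_density_neq lam kw lam0) (ae_scaled_density_neq lam kv lam0)).
  move=> o xi0 [/= X0o xs] [/= ykw ykv]; rewrite /f /g aE bE (WE _ xi0 xs).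
  have y0 : 0 < lam * xi o by rewrite mulr_gt0.
  have yy2 : lam * xi o != y2 by rewrite (inj_eq (mulfI _))// gt_eqF.
  have [->|XW'] := eqVneq (X o) (switch w v y2 (lam * xi o)).
    by rewrite (switch_meets hw hv)// ltr_pM2l.
  have := switch_lagrangian hw hv _ _ _ y20 vL y0 yy2 ykw ykv X0o XW'.
  rewrite ltr_pM2l// -/mu => lt; have {}lt : u (X o) +
      lam * (xi o * switch w v y2 (lam * xi o)) + mu * (L <= X o)%R%:R <
    u (switch w v y2 (lam * xi o)) + lam * (xi o * X o) +
      mu * (xi o < xi2)%R%:R by lra.
  by split=> //; exact: ltW.
have fg : {ae P, forall o, f o <= g o} by apply: filterS strict => o [].
have Rind (A : set Omega) : measurable A -> \int[P]_o (\1_A o : R) = fine (P A).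
  by move=> mC; rewrite /Rintegral integral_indic// setIT.
have Ifg : \int[P]_o g o - \int[P]_o f o <= \int[P]_o u (W o) - \int[P]_o u (X o).
  rewrite /f /g !RintegralD ?RintegralZl//; try exact: iZ; try by apply/iD => //; exact: iZ.
  rewrite XW !Rind// probability_below_quantile /=.
  have : mu * (1 - alpha) <= mu * fine (P [set o | L <= X o]).
    apply: ler_wpM2l; first exact: (constraint_price_ge0 L0 hw hv).
    by rewrite -lee_fin fineK// fin_num_measure.
  by lra.
split.
  by have := ae_le_Rintegral _ iff ig fg; lra.
move=> WX; have /(ae_le_Rintegral_eq _ iff ig fg) : \int[P]_o g o <= \int[P]_o f o by lra.
apply: filterS2 strict => o [_ lt] fgo; apply/eqP/negPn/negP => /lt.
by rewrite fgo ltxx.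
Qed.

(** The exchange of w and v happens at the price lam * xi2, that is, always
    at the same states xi = xi2 whatever lam. *)
Definition switch_cost (w v : R -> R) (xi2 lam : R) (o : Omega) : R :=
  xi o * switch w v (lam * xi2) (lam * xi o).

Local Notation cost := (switch_cost w v xi2).

Lemma measurable_switch_cost (lam : R) : measurable_fun setT (cost lam).
Proof.
apply: measurable_funM => //.
apply: (measurableT_comp (measurable_switch hw hv (lam * xi2))).
exact: measurable_funM.
Qed.

Lemma switch_cost_ge0 (lam : R) (o : Omega) : 0 < lam -> 0 < xi o ->
  0 <= cost lam o.
Proof.
move=> lam0 xi0; apply: mulr_ge0; first exact: ltW.
by apply: (switch_ge0 L0 hw hv); exact: mulr_gt0.
Qed.

Lemma switch_cost_nincr (lam lam' : R) (o : Omega) : 0 < lam -> lam <= lam' ->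
  0 < xi o -> cost lam' o <= cost lam o.
Proof.
move=> lam0 ll xi0; have lam'0 := lt_le_trans lam0 ll.
have y0 : 0 < lam * xi o by rewrite mulr_gt0.
have yy : lam * xi o <= lam' * xi o by rewrite ler_pM2r.
rewrite /switch_cost ler_pM2l// /switch !ltr_pM2l//; case: ifP => _.
  exact: demand_nincr hw _ _ y0 yy.
exact: demand_nincr hv _ _ y0 yy.
Qed.

Section Multiplier.
Context {lamB : R}.
Hypothesis lamB0 : 0 < lamB.
Hypothesis cost_v : P.-integrable setT (EFin \o (fun o => xi o * v (lamB * xi o))).
Hypothesis v_large : exists2 y, 0 < y & L <= v y.

(** Where v already exceeds the floor, w and v agree; the remaining states
    have a price bounded below, hence a bounded demand w, and the floor is only
    imposed at xi < xi2. So the cost exceeds that of v by a bounded amount. *)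
Lemma integrable_switch_costB : P.-integrable setT (EFin \o cost lamB).
Proof.
have [y1 y10 Lv] := v_large; pose C := xi2 * w y1.
have C0 : 0 <= C := mulr_ge0 (ltW quantile_gt0) (le_trans L0 (demand_ge hw y10)).
apply: (@ae_le_integrable _ _ _ _ _ (fun o => xi o * v (lamB * xi o) + C)).
- exact: measurable_switch_cost.
- apply: filterS2 xi_gt0 (ae_scaled_density_neq lamB kv lamB0) => o xi0 ykv.
  rewrite ger0_norm ?switch_cost_ge0// /switch_cost /switch ltr_pM2l//.
  have y0 : 0 < lamB * xi o by rewrite mulr_gt0.
  case: ltP => xs; last by rewrite lerDl.
  have [yy1|yy1] := ltP (lamB * xi o) y1.
    have Lvy : L <= v (lamB * xi o).
      exact: le_trans Lv (demand_nincr hv _ _ y0 (ltW yy1)).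
    by rewrite (demand_eq hv hw L0 _ y0 ykv Lvy) lerDl.
  rewrite -[leLHS]add0r lerD//.
    exact: (mulr_ge0 (ltW xi0) (demand_ge hv y0)).
  apply: ler_pM; [exact: ltW|exact: le_trans L0 (demand_ge hw y0)|exact: ltW|].
  exact: demand_nincr hw _ _ y10 yy1.
- have iC : P.-integrable setT (EFin \o (cst C : Omega -> R)).
    exact: finite_measure_integrable_cst.
  exact: (integrableD measurableT cost_v iC).
Qed.

(** Dominated convergence: costs decrease with the multiplier, so the cost at
    lamB is a common bound. *)
Lemma switch_cost_cvg (lam_ : nat -> R) (f : Omega -> R) :
  (forall n, lamB <= lam_ n) -> measurable_fun setT f ->
  {ae P, forall o, cost (lam_ n) o @[n --> \oo] --> f o} ->
  \int[P]_o cost (lam_ n) o @[n --> \oo] --> \int[P]_o f o.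
Proof.
move=> lam_ge mf cf.
have bound : {ae P, forall o, forall n, setT o -> (`|(cost (lam_ n) o)%:E| <= (cost lamB o)%:E)%E}.
  apply: filterS xi_gt0 => o xi0 n _; have lam0 := lt_le_trans lamB0 (lam_ge n).
  by rewrite /= ger0_norm ?switch_cost_ge0// lee_fin switch_cost_nincr.
have cfE : {ae P, forall o, setT o -> (cost (lam_ n) o)%:E @[n --> \oo] --> (f o)%:E}.
  by apply: filterS cf => o cfo _; apply: cvg_EFin => //; exact: nearW.
have [] := dominated_convergence measurableT _ _ cfE integrable_switch_costB bound.
- by move=> n; exact/measurable_EFinP/measurable_switch_cost.
- exact/measurable_EFinP.
move=> intf _ cint; apply: fine_cvg; rewrite fineK//.
exact: integrable_fin_num.
Qed.

Lemma integrable_switch_cost (lam : R) : lamB <= lam ->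
  P.-integrable setT (EFin \o cost lam).
Proof.
move=> ll; apply: (@ae_le_integrable _ _ _ _ _ (cost lamB)).
- exact: measurable_switch_cost.
- apply: filterS xi_gt0 => o xi0.
  by rewrite ger0_norm ?switch_cost_nincr// switch_cost_ge0// (lt_le_trans lamB0).
- exact: integrable_switch_costB.
Qed.

(** The cost need not be finite below lamB, so it is frozen there to obtain a
    function on the whole line. *)
Lemma switch_cost_continuous :
  continuous (fun lam => \int[P]_o cost (Num.max lam lamB) o).
Proof.
move=> lam; apply/(@cvg_nbhsP _ R^o) => lam_ clam.
have mlamB (a : R) : lamB <= Num.max a lamB by rewrite le_max lexx orbT.
have m0 (a : R) : 0 < Num.max a lamB := lt_le_trans lamB0 (mlamB a).
have cmax : Num.max (lam_ n) lamB @[n --> \oo] --> Num.max lam lamB.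
  have cmax : {for lam, continuous (fun a : R => Num.max a lamB)}.
    by apply: (@continuous_max R R id (cst lamB)); [exact: cvg_id|exact: cvg_cst].
  exact: (cvg_comp _ _ clam cmax).
apply: (switch_cost_cvg (fun n => Num.max (lam_ n) lamB)) => //.
  exact: measurable_switch_cost.
apply: filterS3 xi_gt0 (ae_scaled_density_neq _ kw (m0 lam))
  (ae_scaled_density_neq _ kv (m0 lam)) => o xi0 ykw ykv.
apply: cvgM; first exact: cvg_cst.
have cy : Num.max (lam_ n) lamB * xi o @[n --> \oo] --> Num.max lam lamB * xi o.
  by apply: cvgM => //; exact: cvg_cst.
have y0 : 0 < Num.max lam lamB * xi o by rewrite mulr_gt0.
rewrite /switch ltr_pM2l//; under eq_fun do rewrite ltr_pM2l//.
case: ifP => _.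
  exact: (cvg_comp _ _ cy (demand_continuous hw y0 ykw)).
exact: (cvg_comp _ _ cy (demand_continuous hv y0 ykv)).
Qed.

Lemma switch_cost_infty :
  \int[P]_o cost (lamB + n%:R) o @[n --> \oo] -->
  \int[P]_o (xi o * (L * (xi o < xi2)%R%:R)).
Proof.
apply: switch_cost_cvg.
- by move=> n; rewrite lerDl.
- apply: measurable_funM => //; apply: measurable_funM => //.
  by apply: measurable_natmul_bool; exact: measurable_fun_ltr.
apply: filterS xi_gt0 => o xi0; apply: cvgM; first exact: cvg_cst.
have cy : (lamB + n%:R) * xi o @[n --> \oo] --> +oo.
  apply/cvgryPge => A; near=> n; rewrite -ler_pdivrMr// -lerBlDl.
  by near: n; move/cvgryPge : (@cvgr_idn R); exact.
have l0 n : 0 < lamB + n%:R by rewrite ltr_pwDl.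
rewrite /switch; under eq_fun do rewrite ltr_pM2l//.
case: (xi o < xi2); rewrite ?mulr1 ?mulr0.
  exact: (cvg_comp _ _ cy (demand_cvg hw)).
exact: (cvg_comp _ _ cy (demand_cvg hv)).
Unshelve. all: by end_near.
Qed.

Lemma exists_multiplier (x : R) : x <= \int[P]_o cost lamB o ->
  \int[P]_o (xi o * (L * (xi o < xi2)%R%:R)) < x ->
  exists2 lam, lamB <= lam & \int[P]_o cost lam o = x.
Proof.
move=> xB xoo.
have [n nx] : exists n : nat, \int[P]_o cost (lamB + n%:R) o < x.
  have := cvgr_lt _ switch_cost_infty x xoo.
  by move=> /(_ _)/filter_ex.
pose F lam := \int[P]_o cost (Num.max lam lamB) o.
have ln : lamB <= lamB + n%:R by rewrite lerDl.
have FB : F lamB = \int[P]_o cost lamB o by rewrite /F maxxx.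
have Fn : F (lamB + n%:R) = \int[P]_o cost (lamB + n%:R) o by rewrite /F (max_idPl ln).
have [] := @IVT _ F lamB (lamB + n%:R) x ln.
- exact/continuous_subspaceT/switch_cost_continuous.
- by rewrite FB Fn ge_min le_max (ltW nx) xB orbT.
move=> lam; rewrite in_itv/= => /andP[ll _] <-; exists lam => //.
by rewrite /F (max_idPl ll).
Qed.

End Multiplier.
End Verification.
End Density.

(** * The state price density *)

Lemma expectation_integrable {R : realType} {d : measure_display}
    {T : measurableType d} (P : probability T R) {f : T -> R} {x : R} :
  measurable_fun setT f -> {ae P, forall o, 0 <= f o} ->
  ('E_P[f] = x%:E)%E ->
  P.-integrable setT (EFin \o f) /\ \int[P]_o f o = x.
Proof.
rewrite unlock => mf f0 fx; split; last by rewrite /Rintegral fx.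
by apply: ae_ge0_integrable => //; rewrite fx ltry.
Qed.

Lemma integrable_expectationE {R : realType} {d : measure_display}
    {T : measurableType d} (P : probability T R) {f : T -> R} :
  P.-integrable setT (EFin \o f) -> ('E_P[f] = (\int[P]_o f o)%:E)%E.
Proof.
by move=> intf; rewrite unlock /Rintegral fineK//; exact: integrable_fin_num.
Qed.

Section StatePriceDensity.
Context {R : realType} {d : measure_display} {Omega : measurableType d} {m : nat}.
Variables (P Q : probability Omega R) (M : @market R d Omega m).
Hypothesis hM : complete_market P Q M.
Local Notation xi := (state_price_density P Q M).

Let measurable_price0 (t : R) : 0 <= t <= horizon M ->
  measurable_fun setT (price M ord0 t).
Proof.
move=> tT _ B mB; rewrite setTI.
have := price_adapted hM ord0 tT mB.
have [_ mono FT] := filt_filtration hM; case/andP: tT => t0 tT.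
by move=> /(mono t (horizon M) t0 tT (lexx _)); rewrite FT.
Qed.

Let horizon_itv : 0 <= horizon M <= horizon M.
Proof. by rewrite lexx ltW// (horizon_gt0 hM). Qed.

Let time0_itv : (0 : R) <= 0 <= horizon M.
Proof. by rewrite lexx ltW// (horizon_gt0 hM). Qed.

Let dominated : charge_of_finite_measure Q `<< P.
Proof. by have [] := lmm hM. Qed.

Local Notation rn := (Radon_Nikodym (charge_of_finite_measure Q) P).

Let measurable_rn : measurable_fun setT (fun o => fine (rn o)).
Proof.
exact: measurableT_comp.
Qed.

Lemma measurable_state_price_density : measurable_fun setT xi.
Proof.
apply: measurable_funM => //; apply: measurable_funM; first exact: measurable_price0.
have mT := measurable_price0 _ horizon_itv.
(* an inverse of a positive function, written with measurable functions *)
apply: (eq_measurable_fun (fun o => expR (- ln (price M ord0 (horizon M) o)))).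
  move=> o _; rewrite expRN lnK//.
  exact: (price0_gt0 hM _ horizon_itv).
apply: measurableT_comp => //; apply: measurableT_comp => //.
exact: measurableT_comp.
Qed.

(** The derivative is positive almost surely because P and Q have the same
    null sets: Q does not charge the set where it is nonpositive. *)
Lemma state_price_density_gt0 : {ae P, forall o, 0 < xi o}.
Proof.
pose N := [set o | fine (rn o) <= 0].
have mN : measurable N by exact: measurable_le.
have QN : Q N = 0%E.
  apply/eqP; rewrite eq_le measure_ge0 andbT.
  have -> : Q N = charge_of_finite_measure Q N by [].
  rewrite (Radon_Nikodym_integral dominated mN).
  rewrite -(@integral0 _ _ _ P N); apply: le_integral => //.
  - exact: integrableS (Radon_Nikodym_integrable dominated).
  - exact: integrable0.
  move=> o; rewrite inE => No.
  by rewrite -(fineK (Radon_Nikodym_fin_num o dominated)) lee_fin.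
have [_ /null_content_dominatesP PQ _] := lmm hM.
have PN : P N = 0%E by exact: PQ.
exists N; split => // o /= npos; rewrite /N/=; rewrite leNgt; apply/negP => rn0.
apply: npos; rewrite /state_price_density mulr_gt0// divr_gt0//.
  exact: (price0_gt0 hM _ time0_itv).
exact: (price0_gt0 hM _ horizon_itv).
Qed.

End StatePriceDensity.

(** * Solution of the constrained problem *)

Section Solution.
Context {R : realType} {d : measure_display} {Omega : measurableType d} {m : nat}.
Variables (P Q : probability Omega R) (M : @market R d Omega m).
Variables (U : R -> R) (x0 D L alpha xi2 : R).
Local Notation xi := (state_price_density P Q M).
Local Notation u := (debt_utility U D).
Hypothesis hM : complete_market P Q M.
Hypothesis xi_atomless : forall c : R, P [set o | xi o = c] = 0%E.
Hypothesis L0 : 0 <= L.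
Hypothesis alpha01 : 0 < alpha < 1.
Hypothesis hU : utility U.
Hypothesis solution_ex : exists X, VaR_solution P Q M U x0 D L alpha X.
Hypothesis tail_xi2 : P [set o | xi2 < xi o] = alpha%:E.

Context {w v : R -> R} {kw kv lamB : R}.
Hypothesis hw : demand u L kw w.
Hypothesis hv : demand u 0 kv v.
Hypothesis v_large : exists2 y, 0 < y & L <= v y.
Hypothesis budget_v : budget P Q M x0 (fun lam s => v (lam * s)) lamB.
Hypothesis v_infeasible :
  (P [set o | (L <= v (lamB * xi o))%R] < (1 - alpha)%:E)%E.

Let mxi := measurable_state_price_density P Q M hM.
Let xi_gt0 := state_price_density_gt0 P Q M hM.
Let xi2_gt0 : 0 < xi2 := quantile_gt0 P xi mxi xi_gt0 xi_atomless alpha01 tail_xi2.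
Let lamB0 : 0 < lamB. Proof. by have [] := budget_v. Qed.

Let mv : measurable_fun setT (fun o => v (lamB * xi o)).
Proof.
apply: (measurableT_comp (demand_measurable hv)); exact: measurable_funM.
Qed.

(** Otherwise the unconstrained optimum, which decreases with the state price,
    would be at least L on xi < xi2, an event of probability 1 - alpha. *)
Lemma unconstrained_violates : v (lamB * xi2) < L.
Proof.
rewrite ltNge; apply/negP => Lv; move: v_infeasible.
rewrite ltNge (quantile_le_constraint P xi mxi xi_atomless tail_xi2 mv)//.
apply: filterS xi_gt0 => o xi0 xs; apply: le_trans Lv _.
apply: (demand_nincr hv); last by rewrite ler_pM2l// ltW.
exact: mulr_gt0.
Qed.

Let cost_v : P.-integrable setT (EFin \o (fun o => xi o * v (lamB * xi o))) /\
  \int[P]_o (xi o * v (lamB * xi o)) = x0.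
Proof.
apply: expectation_integrable.
- exact: measurable_funM.
- apply: filterS xi_gt0 => o xi0; apply: mulr_ge0; first exact: ltW.
  by apply: (demand_ge hv); exact: mulr_gt0.
- by have [] := budget_v.
Qed.

Variable W : R -> R -> R.
Hypothesis mW : forall lam, 0 < lam -> measurable_fun setT (W lam).
Hypothesis W_below : forall lam s, 0 < lam -> 0 < s -> s < xi2 ->
  W lam s = w (lam * s).
Hypothesis W_above : forall lam s, lamB <= lam -> xi2 < s ->
  W lam s = v (lam * s).
Hypothesis W_above_ge : forall lam s, 0 < lam -> lam < lamB -> xi2 < s ->
  v (lamB * s) <= W lam s.

Let wealth_measurable lam : 0 < lam ->
  measurable_fun setT (fun o => W lam (xi o)).
Proof. by move=> lam0; exact: measurableT_comp (mW _ lam0) mxi. Qed.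

Let wealth_ge0 lam : 0 < lam -> {ae P, forall o, 0 <= W lam (xi o)}.
Proof.
move=> lam0; apply: filterS2 xi_gt0 (ae_density_neq P xi mxi xi_atomless xi2) => o xi0.
rewrite neq_lt => /orP[xs|sx].
  by rewrite W_below// (le_trans L0)// (demand_ge hw)// mulr_gt0.
have [ll|ll] := leP lamB lam.
  by rewrite W_above// (demand_ge hv)// mulr_gt0.
by apply: le_trans (W_above_ge lam (xi o) lam0 ll sx); rewrite (demand_ge hv)// mulr_gt0.
Qed.

Let wealth_meets lam : 0 < lam ->
  {ae P, forall o, xi o < xi2 -> L <= W lam (xi o)}.
Proof.
move=> lam0; apply: filterS xi_gt0 => o xi0 xs.
by rewrite W_below// (demand_ge hw)// mulr_gt0.
Qed.

Let wealth_cost lam : budget P Q M x0 W lam ->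
  P.-integrable setT (EFin \o (fun o => xi o * W lam (xi o))) /\
  \int[P]_o (xi o * W lam (xi o)) = x0.
Proof.
move=> [lam0 hlam]; apply: expectation_integrable => //.
- apply: measurable_funM => //; exact: wealth_measurable.
- by apply: filterS2 xi_gt0 (wealth_ge0 _ lam0) => o xi0 W0; rewrite mulr_ge0// ltW.
Qed.

(** A budget multiplier below lamB would give a wealth above the
    unconstrained optimum at the same cost, so the two would be equal, and the
    unconstrained optimum would satisfy the constraint. *)
Lemma budget_multiplier_ge lam : budget P Q M x0 W lam -> lamB <= lam.
Proof.
move=> hlam; rewrite leNgt; apply/negP => ll; have [lam0 _] := hlam.
have [iW cW] := wealth_cost _ hlam; have [iv cv] := cost_v.
move: v_infeasible; apply/negP; rewrite -leNgt.
apply: (same_cost_feasible P xi mxi xi_gt0 xi_atomless tail_xi2 mv iv iW).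
- apply: filterS3 xi_gt0 (ae_density_neq P xi mxi xi_atomless xi2)
    (ae_scaled_density_neq P xi mxi xi_atomless lamB kv lamB0) => o xi0 + ykv.
  have y0 : 0 < lamB * xi o by rewrite mulr_gt0.
  rewrite neq_lt => /orP[xs|sx]; last exact: W_above_ge.
  rewrite W_below//; apply: le_trans (demand_le hv hw L0 _ y0 ykv) _.
  by apply: (demand_nincr hw); [exact: mulr_gt0|rewrite ler_pM2r// ltW].
- exact: wealth_meets.
- by rewrite cW cv.
Qed.

Let wealth_switch lam : lamB <= lam -> forall o, 0 < xi o -> xi o != xi2 ->
  W lam (xi o) = switch w v (lam * xi2) (lam * xi o).
Proof.
move=> ll o xi0; have lam0 := lt_le_trans lamB0 ll.
rewrite /switch ltr_pM2l// neq_lt => /orP[xs|sx].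
  by rewrite xs W_below.
by rewrite ltNge (ltW sx)/= W_above.
Qed.

Lemma wealth_feasible lam : budget P Q M x0 W lam ->
  VaR_feasible P Q M x0 L alpha (W lam \o xi).
Proof.
move=> hlam; have [lam0 EW] := hlam; split.
- split=> //; [exact: wealth_measurable| |exact: wealth_ge0].
  apply: (completeness hM); [exact: wealth_measurable|exact: wealth_ge0|].
  by rewrite EW ltry.
- apply: (quantile_le_constraint P xi mxi xi_atomless tail_xi2).
    exact: wealth_measurable.
  exact: wealth_meets.
- by rewrite EW.
Qed.

Let feasible_integrable X : VaR_feasible P Q M x0 L alpha X ->
  P.-integrable setT (EFin \o (fun o => u (X o))) /\
  P.-integrable setT (EFin \o (fun o => xi o * X o)) /\
  \int[P]_o (xi o * X o) = x0.
Proof.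
move=> fX; have [[mX _ X0 EX] _ _] := fX; split; last first.
  apply: expectation_integrable => //; first exact: measurable_funM.
  by apply: filterS2 xi_gt0 X0 => o xi0 Xo; rewrite mulr_ge0// ltW.
apply: ae_ge0_integrable.
- exact: measurableT_comp (measurable_debt_utility U D hU) mX.
- by apply: nearW => o; exact: debt_utility_ge0.
- have [Y [_ Yoo /(_ _ fX) XY]] := solution_ex.
  by have := le_lt_trans XY Yoo; rewrite /objective unlock.
Qed.

(** The existence of some optimal wealth is what makes every expected utility
    in the comparison finite. *)
Lemma budget_optimal lam : budget P Q M x0 W lam ->
  VaR_solution P Q M U x0 D L alpha (W lam \o xi) /\
  forall X, VaR_solution P Q M U x0 D L alpha X ->
    {ae P, forall o, X o = W lam (xi o)}.
Proof.
move=> hlam; have ll := budget_multiplier_ge _ hlam; have lam0 := lt_le_trans lamB0 ll.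
have fW := wealth_feasible _ hlam.
have [iuW [iW cW]] := feasible_integrable _ fW.
have vL : v (lam * xi2) < L.
  apply: le_lt_trans unconstrained_violates.
  by apply: (demand_nincr hv); [exact: mulr_gt0|rewrite ler_pM2r].
have compare X : VaR_feasible P Q M x0 L alpha X ->
    \int[P]_o u (X o) <= \int[P]_o u (W lam (xi o)) /\
    (\int[P]_o u (W lam (xi o)) <= \int[P]_o u (X o) ->
     {ae P, forall o, X o = W lam (xi o)}).
  move=> fX; have [[mX _ X0 _] PX _] := fX.
  have [iuX [iX cX]] := feasible_integrable _ fX.
  apply: (switch_optimal P xi mxi xi_gt0 xi_atomless alpha01 tail_xi2 L0 hw hv lam) => //.
    exact: wealth_switch.
  by rewrite cX cW.
have objE X : VaR_feasible P Q M x0 L alpha X ->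
    objective P U D X = (\int[P]_o u (X o))%:E.
  by move=> fX; have [iuX _] := feasible_integrable _ fX; exact: integrable_expectationE.
split.
  split=> //; first by rewrite objE// ltry.
  by move=> Y fY; rewrite !objE// lee_fin; have [] := compare _ fY.
move=> X [fX _ /(_ _ fW)]; rewrite !objE// lee_fin.
by have [_] := compare _ fX; exact.
Qed.

(** At lamB the candidate dominates the unconstrained optimum, whose cost is
    x0; its cost decreases continuously to that of L on xi < xi2. *)
Lemma budget_multiplier_ex :
  ('E_P[fun o => (xi o * (L * (xi o < xi2)%R%:R))%R] < x0%:E)%E ->
  exists lam, budget P Q M x0 W lam.
Proof.
move=> Lx0; have [iv cv] := cost_v.
have iB := integrable_switch_costB P xi mxi xi_gt0 xi_atomless alpha01
  tail_xi2 L0 hw hv lamB0 iv v_large.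
have [] := exists_multiplier P xi mxi xi_gt0 xi_atomless alpha01
  tail_xi2 L0 hw hv lamB0 iv v_large x0.
- rewrite -cv; apply: (ae_le_Rintegral _ iv iB).
  apply: filterS2 xi_gt0 (ae_scaled_density_neq P xi mxi xi_atomless lamB kv lamB0) => o xi0 ykv.
  have y0 : 0 < lamB * xi o by rewrite mulr_gt0.
  rewrite /switch_cost ler_pM2l// /switch; case: ifP => _ //.
  exact: demand_le hv hw L0 _ y0 ykv.
- rewrite -lte_fin -integrable_expectationE//; apply: ae_ge0_integrable.
  + apply: measurable_funM => //; apply: measurable_funM => //.
    by apply: measurable_natmul_bool; exact: measurable_fun_ltr.
  + apply: filterS xi_gt0 => o xi0; apply: mulr_ge0; first exact: ltW.
    exact: mulr_ge0.
  + by move: Lx0; rewrite unlock => /lt_trans; apply; rewrite ltry.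
move=> lam ll clam; have lam0 := lt_le_trans lamB0 ll; exists lam; split => //.
have ic := integrable_switch_cost P xi mxi xi_gt0 xi_atomless alpha01
  tail_xi2 L0 hw hv lamB0 iv v_large _ ll.
rewrite -clam -(integrable_expectationE _ ic) unlock; apply: ae_eq_integral => //.
- by apply/measurable_EFinP/measurable_funM => //; exact: wealth_measurable.
- by apply/measurable_EFinP; exact: (measurable_switch_cost xi mxi hw hv).
apply: filterS2 xi_gt0 (ae_density_neq P xi mxi xi_atomless xi2) => o xi0 xs _.
by rewrite /switch_cost (wealth_switch _ ll).
Qed.

Lemma solved_by_switch : solved_by P Q M U x0 D L alpha xi2 W.
Proof. by split; [exact: budget_multiplier_ex|exact: budget_optimal]. Qed.

End Solution.

(** * The three candidate wealths *)

Section Wealths.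
Context {R : realType} (U : R -> R) (D L hatD Ltilde : R) (hU : utility U).
Hypothesis D0 : 0 < D.

Local Notation free := (fun y => inv_marginal U y + D).
Local Notation k3 := (derive1 U (hatD - D)).
Local Notation v := (cutoff free 0 k3).

Let lt_threshold (lam k s : R) : 0 < lam -> (s < k / lam) = (lam * s < k).
Proof. by move=> lam0; rewrite ltr_pdivlMr// mulrC. Qed.

Let threshold_le (lam k s : R) : 0 < lam -> (k / lam <= s) = (k <= lam * s).
Proof. by move=> lam0; rewrite ler_pdivrMr// mulrC. Qed.

Lemma wealth_B_cutoff (lam s : R) : 0 < lam -> wealth_B U D hatD lam s = v (lam * s).
Proof.
move=> lam0; rewrite /wealth_B /cutoff lt_threshold//.
by case: ifP => _; rewrite ?mulr1 ?mulr0.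
Qed.

Lemma wealth_VaR_i_below (xi2 lam s : R) : 0 < lam -> s < xi2 ->
  wealth_VaR_i U D L Ltilde xi2 lam s =
  (if L == D then free (lam * s)
   else cutoff free L (derive1 U (Ltilde - (D - L))) (lam * s)).
Proof.
move=> lam0 sx; rewrite /wealth_VaR_i; case: (L == D).
  by rewrite leey sx mulr1.
rewrite lee_fin lte_fin lee_fin sx lt_threshold// threshold_le// /cutoff.
set k := derive1 U _; case: (leP xi2 (k / lam)) => [xk|_].
  by rewrite mulr1 ifT// -lt_threshold// (lt_le_trans sx).
by case: ltP => _; rewrite ?mulr1 ?mulr0 ?addr0 ?add0r.
Qed.

Lemma wealth_VaR_i_above (xi2 lam s : R) : xi2 < s ->
  wealth_VaR_i U D L Ltilde xi2 lam s = 0.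
Proof.
move=> xs; rewrite /wealth_VaR_i [s < xi2]ltNge (ltW xs)/= andbF !mulr0 addr0.
set xi1 : \bar R := if _ then _ else _; case: (leP xi2%:E xi1) => // xi1x.
by rewrite ltNge (ltW (lt_trans xi1x _)) ?lte_fin// mulr0.
Qed.

Let measurable_wealth_free (lam : R) : measurable_fun setT (wealth_free U D lam).
Proof.
apply: measurable_funD => //.
apply: (measurableT_comp (measurable_inv_marginal U hU)); exact: measurable_funM.
Qed.

Let measurable_wealth_free_on (lam : R) (b : R -> bool) : measurable_fun setT b ->
  measurable_fun setT (fun s => wealth_free U D lam s * (b s)%:R).
Proof.
move=> mb; apply: measurable_funM; first exact: measurable_wealth_free.
exact: measurable_natmul_bool.
Qed.

Let measurable_debt_on (b : R -> bool) : measurable_fun setT b ->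
  measurable_fun setT (fun s : R => L * (b s)%:R).
Proof. by move=> mb; apply: measurable_funM => //; exact: measurable_natmul_bool. Qed.

Let measurable_lt_cst (c : R) : measurable_fun setT (fun s : R => s < c).
Proof. exact: measurable_fun_ltr. Qed.

Let measurable_cst_lt (c : R) : measurable_fun setT (fun s : R => c < s).
Proof. exact: measurable_fun_ltr. Qed.

Let measurable_cst_le (c : R) : measurable_fun setT (fun s : R => c <= s).
Proof. exact: measurable_fun_ler. Qed.

Lemma measurable_wealth_VaR_i (xi2 lam : R) :
  measurable_fun setT (wealth_VaR_i U D L Ltilde xi2 lam).
Proof.
rewrite /wealth_VaR_i; case: (L == D).
  by rewrite leey; exact: measurable_wealth_free_on.
rewrite lee_fin; case: (xi2 <= _); first exact: measurable_wealth_free_on.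
under eq_fun do rewrite lte_fin lee_fin.
apply: measurable_funD; first exact: measurable_wealth_free_on.
by apply: measurable_debt_on; exact: measurable_and.
Qed.

Lemma wealth_VaR_ii_below (xi2 lam s : R) : 0 < lam -> s < xi2 ->
  wealth_VaR_ii U D L xi2 lam s = cutoff free L (derive1 U (L - D)) (lam * s).
Proof.
move=> lam0 sx; rewrite /wealth_VaR_ii sx andbT [s < _ / lam]lt_threshold// threshold_le// /cutoff.
set k := derive1 U _; case: (ltP xi2 (k / lam)) => [xk|_].
  by rewrite mulr1 ifT// -lt_threshold// (lt_trans sx).
by case: ltP => _; rewrite ?mulr1 ?mulr0 ?addr0 ?add0r.
Qed.

Lemma wealth_VaR_ii_above (xi2 lam s : R) : xi2 < s ->
  wealth_VaR_ii U D L xi2 lam s = 0.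
Proof.
move=> xs; rewrite /wealth_VaR_ii [s < xi2]ltNge (ltW xs)/= andbF !mulr0 addr0.
by case: ltP => // kx; rewrite ltNge (le_trans kx (ltW xs)) mulr0.
Qed.

Lemma measurable_wealth_VaR_ii (xi2 lam : R) :
  measurable_fun setT (wealth_VaR_ii U D L xi2 lam).
Proof.
rewrite /wealth_VaR_ii; case: (xi2 < _); first exact: measurable_wealth_free_on.
apply: measurable_funD; first exact: measurable_wealth_free_on.
by apply: measurable_debt_on; exact: measurable_and.
Qed.

Lemma wealth_VaR_iii_below (xi2 lam s : R) : 0 < lam -> s < xi2 ->
  wealth_VaR_iii U D L hatD xi2 lam s =
  cutoff free L (derive1 U (L - D)) (lam * s).
Proof.
move=> lam0 sx; rewrite /wealth_VaR_iii sx [xi2 < s]ltNge (ltW sx)/= mulr0 addr0.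
rewrite if_same andbT [s < _ / lam]lt_threshold// threshold_le// /cutoff.
by case: ltP => _; rewrite ?mulr1 ?mulr0 ?addr0 ?add0r.
Qed.

(** Equality fails for small multipliers: on the states between xi2 and xi1
    the first and the third term of the formula are both present, and the free
    wealth is counted twice. The budget equation excludes such multipliers. *)
Lemma wealth_VaR_iii_above_ge (xi2 lam s : R) : 0 < lam -> 0 < s -> xi2 < s ->
  v (lam * s) <= wealth_VaR_iii U D L hatD xi2 lam s.
Proof.
move=> lam0 s0 xs; have y0 : 0 < lam * s by rewrite mulr_gt0.
have f0 : 0 <= wealth_free U D lam s.
  by rewrite /wealth_free addr_ge0// ltW// inv_marginal_gt0.
rewrite /wealth_VaR_iii xs [s < xi2]ltNge (ltW xs)/= andbF mulr0 addr0.
rewrite /cutoff -lt_threshold//; case: (ltP xi2 (k3 / lam)) => [xk|kx].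
  case: (s < k3 / lam); first by rewrite mulr1 lerDr mulr_ge0.
  by rewrite mulr0 addr0 mulr_ge0.
rewrite [s < k3 / lam]ltNge (le_trans kx (ltW xs))/=.
exact: mulr_ge0.
Qed.

Lemma wealth_VaR_iii_above (xi2 lam s : R) : 0 < lam ->
  derive1 U (L - D) <= lam * s -> xi2 < s ->
  wealth_VaR_iii U D L hatD xi2 lam s = v (lam * s).
Proof.
move=> lam0 ks xs.
rewrite /wealth_VaR_iii xs [s < xi2]ltNge (ltW xs)/= andbF mulr0 addr0.
rewrite [s < _ / lam]lt_threshold// [lam * s < _]ltNge ks mulr0 add0r /cutoff -lt_threshold//.
case: (ltP xi2 (k3 / lam)) => [xk|kx].
  by case: (s < k3 / lam); rewrite ?mulr1 ?mulr0.
by rewrite [s < k3 / lam]ltNge (le_trans kx (ltW xs)).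
Qed.

Lemma measurable_wealth_VaR_iii (xi2 lam : R) :
  measurable_fun setT (wealth_VaR_iii U D L hatD xi2 lam).
Proof.
rewrite /wealth_VaR_iii; case: (xi2 < _); repeat apply: measurable_funD;
  try (exact: measurable_wealth_free_on);
  by [apply: measurable_debt_on; exact: measurable_and|
      apply: measurable_wealth_free_on; exact: measurable_and].
Qed.

End Wealths.

Theorem proposition7 (R : realType) (d : measure_display)
    (Omega : measurableType d) (m : nat) (P Q : probability Omega R)
    (M : @market R d Omega m) (U : R -> R)
    (x0 D L alpha hatD lamB xi2 : R)
    (hM : complete_market P Q M)
    (hatomless : forall c : R,
      P [set w | state_price_density P Q M w = c] = 0%E)
    (hx0 : 0 < x0) (hD : 0 < D) (hL : 0 < L) (halpha : 0 < alpha < 1)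
    (hU : utility U)
    (hhatD : tangent_point U D hatD)
    (hopt : exists X, VaR_solution P Q M U x0 D L alpha X)
    (hB : budget P Q M x0 (wealth_B U D hatD) lamB)
    (hnonred : (P [set w | (L <=
      wealth_B U D hatD lamB (state_price_density P Q M w))%R]
      < (1 - alpha)%:E)%E)
    (hxi2 : P [set w | (xi2 < state_price_density P Q M w)%R] = alpha%:E) :
  [/\ L <= D ->
        forall Ltilde, (L < D -> tangent_point U (D - L) Ltilde) ->
        solved_by P Q M U x0 D L alpha xi2 (wealth_VaR_i U D L Ltilde xi2),
      D < L <= hatD ->
        solved_by P Q M U x0 D L alpha xi2 (wealth_VaR_ii U D L xi2) &
      hatD < L ->
        solved_by P Q M U x0 D L alpha xi2 (wealth_VaR_iii U D L hatD xi2)].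
Proof.
set free := fun y => inv_marginal U y + D.
set k3 := derive1 U (hatD - D).
pose v := cutoff free 0 k3.
have [DhatD _] := hhatD.
have k30 : 0 < k3 by rewrite marginal_gt0// subr_gt0.
have hv : demand (debt_utility U D) 0 k3 v.
  have := demand_below_debt U D hU 0 hatD hD; rewrite subr0; exact.
have v_large : exists2 y, 0 < y & L <= v y by exact: cutoff_free_large.
have [lamB0 EB] := hB.
have BE : wealth_B U D hatD lamB = fun s => v (lamB * s).
  by apply/funext => s; exact: wealth_B_cutoff.
have budget_v : budget P Q M x0 (fun lam s => v (lam * s)) lamB.
  by split => //; rewrite BE in EB.
rewrite BE in hnonred.
have mxi := measurable_state_price_density P Q M hM.
have xi_gt0 := state_price_density_gt0 P Q M hM.
have xi2_gt0 := quantile_gt0 P _ mxi xi_gt0 hatomless halpha hxi2.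
have y20 : 0 < lamB * xi2 by rewrite mulr_gt0.
have vL : v (lamB * xi2) < L.
  exact: (unconstrained_violates P Q M U x0 D L alpha xi2 hM hatomless hxi2 hv
    budget_v hnonred).
have v_above (lam s : R) : lamB <= lam -> xi2 < s -> k3 <= lamB * xi2 -> v (lam * s) = 0.
  move=> ll xs kB; rewrite /v /cutoff ltNge (le_trans kB)//.
  by rewrite ler_pM// ltW.
split.
- move=> LD Ltilde hLt.
  have kB : k3 <= lamB * xi2.
    rewrite leNgt; apply/negP => lt; move: vL; rewrite /v /cutoff lt.
    by have := inv_marginal_gt0 U hU _ y20; rewrite /free; lra.
  have [kw [w [hw wE]]] : exists kw w, demand (debt_utility U D) L kw w /\
      forall lam s, 0 < lam -> s < xi2 ->
        wealth_VaR_i U D L Ltilde xi2 lam s = w (lam * s).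
    have [LeqD|LneqD] := eqVneq L D.
      exists 0, free; split; first by rewrite LeqD; exact: demand_at_debt.
      by move=> lam s lam0 sx; rewrite wealth_VaR_i_below// LeqD eqxx.
    have LltD : L < D by rewrite lt_neqAle LneqD.
    exists (derive1 U (Ltilde - (D - L))), (cutoff free L (derive1 U (Ltilde - (D - L)))).
    split; first exact: demand_below_debt (hLt LltD).
    by move=> lam s lam0 sx; rewrite wealth_VaR_i_below// (negbTE LneqD).
  apply: (solved_by_switch P Q M U x0 D L alpha xi2 hM hatomless (ltW hL) halpha
    hU hopt hxi2 hw hv v_large budget_v hnonred).
  + by move=> lam _; exact: measurable_wealth_VaR_i.
  + by move=> lam s lam0 _; exact: wE.
  + by move=> lam s ll xs; rewrite wealth_VaR_i_above// v_above.
  + by move=> lam s lam0 _ xs; rewrite wealth_VaR_i_above// v_above.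
- move=> /andP[DL LhatD].
  have kB : k3 <= lamB * xi2.
    rewrite leNgt; apply/negP => lt; move: vL; rewrite /v /cutoff lt.
    have : hatD - D < inv_marginal U (lamB * xi2).
      by rewrite lt_inv_marginal// subr_gt0.
    by rewrite /free; lra.
  apply: (solved_by_switch P Q M U x0 D L alpha xi2 hM hatomless (ltW hL) halpha
    hU hopt hxi2 (demand_above_debt U D hU L DL) hv v_large budget_v hnonred).
  + by move=> lam _; exact: measurable_wealth_VaR_ii.
  + by move=> lam s lam0 _; exact: wealth_VaR_ii_below.
  + by move=> lam s ll xs; rewrite wealth_VaR_ii_above// v_above.
  + by move=> lam s lam0 _ xs; rewrite wealth_VaR_ii_above// v_above.
- move=> hatDL; have DL : D < L := lt_trans DhatD hatDL.
  have kB : derive1 U (L - D) <= lamB * xi2.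
    rewrite leNgt; apply/negP => lt; move: vL; rewrite /v /cutoff ifT.
      have : L - D < inv_marginal U (lamB * xi2).
        by rewrite lt_inv_marginal// subr_gt0.
      by rewrite /free; lra.
    apply: lt_trans lt _; apply: marginal_decr => //; first by rewrite subr_gt0.
    by rewrite ltrD2r.
  apply: (solved_by_switch P Q M U x0 D L alpha xi2 hM hatomless (ltW hL) halpha
    hU hopt hxi2 (demand_above_debt U D hU L DL) hv v_large budget_v hnonred).
  + by move=> lam _; exact: measurable_wealth_VaR_iii.
  + by move=> lam s lam0 _; exact: wealth_VaR_iii_below.
  + move=> lam s ll xs; apply: wealth_VaR_iii_above => //.
      exact: lt_le_trans lamB0 ll.
    by apply: le_trans kB _; rewrite ler_pM// ltW.
  + move=> lam s lam0 ll xs; have s0 := lt_trans xi2_gt0 xs.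
    apply: le_trans (wealth_VaR_iii_above_ge U D L hatD hU hD _ _ _ lam0 s0 xs).
    apply: (demand_nincr hv); first exact: mulr_gt0.
    by rewrite ler_pM2r// ltW.
Qed.
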